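(* The family $\{\mathbf{P}_J\}_{J \in \mathcal{TBT}}$ defined by $$\mathbf{P}_J := \sum_{\sigma \in \mathfrak{S},\ \mathbb{P}(\sigma) = J} \mathbf{F}_\sigma$$ spans a Hopf subalgebra of $\mathbf{FQSym}$ (called the Hopf algebra $\mathbf{Baxter}$).
   Context: The ground field $\mathbb{K}$ has characteristic zero. $\mathfrak{S} = \bigcup_{n\ge 0}\mathfrak{S}_n$ is the set of all permutations, seen as words. The standardized word $\mathrm{std}(u)$ of a word $u$ on a totally ordered alphabet is the unique permutation $\sigma$ with $\sigma_i < \sigma_j$ iff $u_i \leq u_j$ for all $1 \leq i < j \leq |u|$. The shifted shuffle of permutations $\sigma,\nu$ is the set (formal sum) of all shuffles of the word $\sigma$ with the word obtained from $\nu$ by adding $|\sigma|$ to each letter; it is denoted $\sigma \mathbin{\overline{\sqcup\!\sqcup}} \nu$. $\mathbf{FQSym}$ is the (graded) Hopf algebra with basis $\{\mathbf{F}_\sigma\}_{\sigma\in\mathfrak{S}}$, product $\mathbf{F}_\sigma\cdot\mathbf{F}_\nu = \sum_{\pi\in\sigma\,\overline{\sqcup\!\sqcup}\,\nu}\mathbf{F}_\pi$ and coproduct $\Delta(\mathbf{F}_\sigma)=\sum_{0\le i\le|\sigma|}\mathbf{F}_{\mathrm{std}(\sigma_1\cdots\sigma_i)}\otimes\mathbf{F}_{\mathrm{std}(\sigma_{i+1}\cdots\sigma_{|\sigma|})}$. Binary trees are planar; each internal node (called node) has a left and a right child, possibly a leaf; $\perp$ is the empty tree. The canopy $\mathrm{cnp}(T)$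 of a binary tree $T$ is the word on $\{0,1\}$ obtained by reading the leaves of $T$ from left to right, omitting the first and the last one, writing $0$ if the leaf is oriented to the right (is the right child of its parent) and $1$ otherwise. A pair of twin binary trees is a pair $(T_L,T_R)$ of binary trees with the same number $n$ of nodes such that $\mathrm{cnp}(T_L)_i \neq \mathrm{cnp}(T_R)_i$ for all $1 \leq i \leq n-1$. $\mathcal{TBT}$ is the set of all pairs of twin binary trees (for all $n \geq 0$). For a permutation $\sigma$, $\mathbb{P}(\sigma) = (T_L, T_R) \in \mathcal{TBT}$ is the pair of unlabeled trees obtained as follows. Start with $(\perp,\perp)$ and insert the letters of $\sigma$ from left to right, inserting each letter $a$ by a leaf insertion in $T_L$ and a root insertion in $T_R$; at the end forget the labels. Leaf insertion of $a$ in a labeled tree: if the tree is empty the result is the one-node tree labeled $a$; otherwise, if $a$ is smaller than the root's label, leaf-insert $a$ in the left subtree, else in the right subtree. Root insertion of $a$ in a binary search tree $T$: the result has a root labeled $a$, left subtree $T_{\leq a}$ and right subtree $T_{>a}$, where $T_{\leq a}$ (resp. $T_{>a}$) is the binary search tree on exactly the nodes of $T$ with label $\leq a$ (resp. $>a$) such that if $x$ is an ancestor of $y$ in it, then $x$ is an ancestor of $y$ in $T$. *)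

(* Defs.v *)
From HB Require Import structures.
From mathcomp Require Import all_boot all_order all_algebra.
From mathcomp Require Import finmap monalg.

Set Implicit Arguments.
Unset Strict Implicit.
Unset Printing Implicit Defensive.

Import GRing.Theory.

Record wperm := WPerm {
  word :> seq nat;
  _ : perm_eq word (iota 1 (size word))
}.

HB.instance Definition _ := [isSub for word].
HB.instance Definition _ := [Countable of wperm by <:].

Definition wperm_nil : wperm := @WPerm [::] isT.

Lemma uniq_wperm (s : wperm) : uniq s.
Proof. by case: s => w /= /perm_uniq ->; apply: iota_uniq. Qed.

(* The i-th letter of std u is the number of letters of u that are smaller
   than u_i, or equal to u_i and not to its right. *)
Definition std_word (u : seq nat) : seq nat :=
  mkseq (fun i => (count (ltn^~ (nth 0 u i)) u
                   + count_mem (nth 0 u i) (take i.+1 u))%N) (size u).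

Lemma count_take_leq (T : Type) (p : pred T) n (s : seq T) :
  count p (take n s) <= count p s.
Proof. by rewrite -[in X in _ <= X](cat_take_drop n s) count_cat leq_addr. Qed.

Section Standardization.
Variable u : seq nat.

Let rk i := (count (ltn^~ (nth 0 u i)) u
             + count_mem (nth 0 u i) (take i.+1 u))%N.

Let rk_le i j : nth 0 u i < nth 0 u j -> rk i < rk j.
Proof.
move=> lt_ij; rewrite /rk.
have h1 : count_mem (nth 0 u i) (take i.+1 u) <= count_mem (nth 0 u i) u.
  exact: count_take_leq.
have h2 : (count (ltn^~ (nth 0 u i)) u + count_mem (nth 0 u i) u
           <= count (ltn^~ (nth 0 u j)) u)%N.
  move: lt_ij; move: (nth 0 u i) (nth 0 u j) => a b lt_ab.
  elim: (u) => //= x v IHv.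
  rewrite addnACA; apply: leq_add => //.
  case: (ltngtP x a) => [lx|lx|->] //=; last by rewrite lt_ab.
  by rewrite (ltn_trans lx lt_ab).
case: (ltnP j (size u)) => hj; last by rewrite (nth_default _ hj) in lt_ij.
have h3 : 0 < count_mem (nth 0 u j) (take j.+1 u).
  rewrite (take_nth 0) // -cats1 count_cat /= eqxx addn0 addn1.
  exact: ltn0Sn.
apply: (@leq_ltn_trans (count (ltn^~ (nth 0 u j)) u)).
  by apply: leq_trans h2; rewrite leq_add2l.
by rewrite -{1}[count _ _]addn0 ltn_add2l.
Qed.

Let rk_eq i j :
  j < size u -> i < j -> nth 0 u i = nth 0 u j -> rk i < rk j.
Proof.
move=> hj lt_ij e; rewrite /rk e ltn_add2l.
rewrite [in X in _ < X](take_nth 0) // -cats1 count_cat /= eqxx addn0 addn1.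
by rewrite ltnS -(take_takel u lt_ij) count_take_leq.
Qed.

Lemma size_std_word : size (std_word u) = size u.
Proof. exact: size_mkseq. Qed.

Lemma std_word_ltE i j : i < j < size u ->
  (nth 0 (std_word u) i < nth 0 (std_word u) j)%N = (nth 0 u i <= nth 0 u j)%N.
Proof.
case/andP=> lt_ij lt_j; have lt_i := ltn_trans lt_ij lt_j.
rewrite !nth_mkseq // -!/(rk _).
case: (ltngtP (nth 0 u i) (nth 0 u j)) => h.
- exact: rk_le.
- by apply/negbTE; rewrite -leqNgt ltnW // rk_le.
- exact: rk_eq.
Qed.

Lemma std_word_perm : perm_eq (std_word u) (iota 1 (size (std_word u))).
Proof.
have uq : uniq (std_word u).
  apply/(uniqP 0) => i j; rewrite !inE => hi hj e.
  have su := size_std_word; rewrite su in hi hj.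
  have neq k l : k < l < size u ->
      nth 0 (std_word u) k <> nth 0 (std_word u) l.
    case/andP=> kl lu; have ku := ltn_trans kl lu; rewrite !nth_mkseq //.
    rewrite -!/(rk _).
    case: (ltngtP (nth 0 u k) (nth 0 u l)) => [/rk_le|/rk_le|/(rk_eq lu kl)];
      by move=> h1 h2; rewrite h2 ltnn in h1.
  case: (ltngtP i j) => // lij.
    by have := @neq i j; rewrite lij hj => /(_ isT).
  by have := @neq j i; rewrite lij hi => /(_ isT) /(_ (esym e)).
apply: uniq_perm => //; first exact: iota_uniq.
have sub : {subset std_word u <= iota 1 (size (std_word u))}.
  move=> x /(nthP 0) [i]; rewrite size_std_word => hi <-.
  rewrite nth_mkseq // mem_iota -/(rk _) add1n ltnS; apply/andP; split.
    rewrite /rk (take_nth 0) // -cats1 count_cat /= eqxx addn0 addn1.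
    by rewrite addnS.
  apply: (@leq_trans (count (ltn^~ (nth 0 u i)) u + count_mem (nth 0 u i) u)%N).
    by rewrite /rk leq_add2l count_take_leq.
  move: (nth 0 u i) => a.
  elim: (u) => //= x' v IHv; rewrite addnACA -[in X in _ <= X]add1n; apply: leq_add => //.
  by case: ltngtP.
have [] // := uniq_min_size uq sub.
by rewrite size_iota.
Qed.

End Standardization.

Definition std (u : seq nat) : wperm := WPerm (std_word_perm u).

Lemma std_unique (u : seq nat) (s : wperm) : size s = size u ->
  (forall i j, (i < j < size u)%N ->
     (nth 0 s i < nth 0 s j)%N = (nth 0 u i <= nth 0 u j)%N) ->
  s = std u.
Proof.
move=> sz hs.
(* a permutation is recovered from its comparisons: s_i is one plus the
   number of indices k with s_k < s_i *)
have E (t : wperm) : size t = size u -> forall i, (i < size u)%N ->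
    nth 0 t i = (count (fun k => nth 0 t k < nth 0 t i) (iota 0 (size u))).+1.
  move=> st i hi.
  have pt : perm_eq t (iota 1 (size t)) by case: (t).
  have ti : (nth 0 t i) \in iota 1 (size t).
    by rewrite -(perm_mem pt) mem_nth // st.
  rewrite -(count_map (nth 0 t) (fun x => x < nth 0 t i)) -st.
  have -> : map (nth 0 t) (iota 0 (size t)) = t.
    by rewrite -[RHS](mkseq_nth 0).
  rewrite (permP pt); move: ti; move: (nth 0 t i) => x.
  rewrite mem_iota => /andP[x0 x1].
  have -> : size t = (x.-1 + (size t - x.-1))%N.
    by rewrite subnKC // (leq_trans (leq_pred x)) // -ltnS -add1n.
  rewrite iotaD count_cat.
  have /eqP -> : count (fun y => y < x) (iota 1 x.-1) == size (iota 1 x.-1).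
    rewrite -all_count; apply/allP => y; rewrite mem_iota => /andP[_].
    by rewrite add1n prednK.
  have /eqP -> : count (fun y => y < x) (iota (1 + x.-1) (size t - x.-1)) == 0.
    rewrite -leqn0 leqNgt -has_count; apply/hasPn => y; rewrite mem_iota.
    by rewrite add1n prednK // -leqNgt => /andP[].
  by rewrite size_iota addn0 prednK.
have cmp i j : (i < size u)%N -> (j < size u)%N ->
    (nth 0 s i < nth 0 s j)%N = (nth 0 (std u) i < nth 0 (std u) j)%N.
  move=> hi hj; case: (ltngtP i j) => ij; last by rewrite ij !ltnn.
    by rewrite hs ?ij // std_word_ltE ?ij.
  have neq (t : wperm) : size t = size u -> nth 0 t i != nth 0 t j.
    by move=> st; rewrite nth_uniq ?st ?uniq_wperm // gtn_eqF.
  have := hs j i; rewrite ij hi => /(_ isT) h1.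
  have := @std_word_ltE u j i; rewrite ij hi => /(_ isT) h2.
  rewrite !ltn_neqAle neq // neq ?size_std_word // !andTb.
  by rewrite leqNgt h1 -h2 -leqNgt.
apply: val_inj; apply: (@eq_from_nth _ 0); first by rewrite size_std_word.
move=> i; rewrite sz => hi; rewrite E // [RHS]E ?size_std_word //.
congr _.+1; apply: eq_in_count => k; rewrite mem_iota => /andP[_ hk].
exact: cmp.
Qed.

Fixpoint shuffle (u : seq nat) : seq nat -> seq (seq nat) :=
  match u with
  | [::] => fun v => [:: v]
  | a :: u' => fix shuffle_u v :=
      match v with
      | [::] => [:: u]
      | b :: v' => map (cons a) (shuffle u' v) ++ map (cons b) (shuffle_u v')
      end
  end.

Definition shifted_shuffle_words (s t : wperm) : seq (seq nat) :=
  shuffle s (map (addn (size s)) t).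

(* insub discards nothing here, see map_shifted_shuffle *)
Definition shifted_shuffle (s t : wperm) : seq wperm :=
  pmap insub (shifted_shuffle_words s t).

Lemma shuffle_perm u v w : w \in shuffle u v -> perm_eq w (u ++ v).
Proof.
elim: u v w => [|a u IHu] v w; first by rewrite inE => /eqP ->.
elim: v w => [|b v IHv] w; first by rewrite inE cats0 => /eqP ->.
rewrite mem_cat => /orP[] /mapP[w' hw' ->].
  by rewrite cat_cons perm_cons; apply: IHu.
apply: (@perm_trans _ (b :: (a :: u) ++ v)).
  by rewrite perm_cons; apply: IHv.
by rewrite -cat1s -[b :: v]cat1s perm_catCA.
Qed.

Lemma shuffle_uniq u v : uniq (u ++ v) -> uniq (shuffle u v).
Proof.
elim: u v => [|a u IHu] // v; elim: v => [|b v IHv] // uv /=.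
rewrite cat_uniq !map_inj_uniq; try by move=> x y [].
apply/and3P; split.
- by apply: IHu; case/andP: uv.
- apply/hasPn => x /mapP[y _ ->]; apply/mapP => -[z _ [e _]].
  by move: uv; rewrite e /= mem_cat inE eqxx orbT.
- apply: IHv; apply: subseq_uniq uv.
  by rewrite cat_subseq // subseq_cons.
Qed.

Lemma map_shifted_shuffle s t :
  map val (shifted_shuffle s t) = shifted_shuffle_words s t.
Proof.
rewrite /shifted_shuffle (pmap_filter (insubK _)).
apply/all_filterP/allP => w /shuffle_perm pw.
rewrite /= isSome_insub /= (perm_size pw) size_cat size_map.
apply: perm_trans pw _.
rewrite iotaD; apply: perm_cat; first by case: (s).
rewrite addnC [iota (_ + 1) _]iotaDl; apply: perm_map; by case: (t).
Qed.

Lemma shifted_shuffle_uniq s t : uniq (shifted_shuffle s t).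
Proof.
rewrite -(map_inj_uniq val_inj) map_shifted_shuffle; apply: shuffle_uniq.
rewrite cat_uniq map_inj_uniq ?uniq_wperm; last exact: addnI.
rewrite andbT /=; apply/hasPn => x /mapP[y yt ->].
have ps : perm_eq s (iota 1 (size s)) by case: (s).
have pt : perm_eq t (iota 1 (size t)) by case: (t).
rewrite (perm_mem ps) mem_iota; move: yt; rewrite (perm_mem pt) mem_iota.
move=> /andP[y0 _]; rewrite negb_and; apply/orP; right.
by rewrite -leqNgt add1n -[X in X < _]addn0 ltn_add2l.
Qed.

Section LinearExtension.
Local Open Scope ring_scope.
Variables (K : fieldType) (B : choiceType) (V : lmodType K).

Definition linext (f : B -> V) (x : {malg K[B]}) : V :=
  \sum_(b <- msupp x) x@_b *: f b.

Lemma linextEw (f : B -> V) (d : {fset B}) x : (msupp x `<=` d)%fset ->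
  linext f x = \sum_(b <- d) x@_b *: f b.
Proof.
move=> le_d; rewrite /linext (big_fset_incl _ le_d) //= => b _ /mcoeff_outdom ->.
by rewrite scale0r.
Qed.

Lemma linext_is_linear f : linear (linext f).
Proof.
move=> a x y; set d := (msupp x `|` msupp y)%fset.
rewrite (@linextEw _ d (a *: x + y)); last first.
  apply: fsubset_trans (msuppD_le _ _) _.
  by apply: fsetSU; apply: msuppZ_le.
rewrite (@linextEw _ d x) ?fsubsetUl // (@linextEw _ d y) ?fsubsetUr //.
rewrite scaler_sumr -big_split; apply: eq_bigr => b _ /=.
by rewrite mcoeffD mcoeffZ scalerDl scalerA.
Qed.

HB.instance Definition _ f :=
  GRing.isLinear.Build K {malg K[B]} V *:%R (linext f) (linext_is_linear f).

Lemma linextU f b : linext f << b >> = f b.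
Proof.
rewrite (@linextEw _ [fset b]%fset) ?msuppU_le // big_seq_fset1.
by rewrite mcoeffUU scale1r.
Qed.

End LinearExtension.

Notation FQSym K := {malg K[wperm]}.

(* FQSym (x) FQSym, as the free module on pairs of permutations: the basis
   element << (s, t) >> stands for F_s (x) F_t. *)
Notation FQSym2 K := {malg K[(wperm * wperm)%type]}.

Section FQSymStructure.
Local Open Scope ring_scope.
Variable K : fieldType.

Definition F (s : wperm) : FQSym K := << s >>.

Definition tensor (x y : FQSym K) : FQSym2 K :=
  linext (fun s => linext (fun t => << (s, t) >> : FQSym2 K) y) x.

Definition fqmul (x y : FQSym K) : FQSym K :=
  linext (fun s => linext (fun t => \sum_(p <- shifted_shuffle s t) F p) y) x.

Definition fqone : FQSym K := F wperm_nil.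

Definition fqcomul (x : FQSym K) : FQSym2 K :=
  linext (fun s : wperm => \sum_(i < (size s).+1)
            tensor (F (std (take i s))) (F (std (drop i s)))) x.

Lemma tensorFF s t : tensor (F s) (F t) = << (s, t) >>.
Proof. by rewrite /tensor /F !linextU. Qed.

Lemma fqmulFF s t : fqmul (F s) (F t) = \sum_(p <- shifted_shuffle s t) F p.
Proof. by rewrite /fqmul /F !linextU. Qed.

Lemma fqcomulF (s : wperm) : fqcomul (F s) =
  \sum_(i < (size s).+1) tensor (F (std (take i s))) (F (std (drop i s))).
Proof. by rewrite /fqcomul {1}/F linextU. Qed.

Definition fqcounit (x : FQSym K) : K := x@_wperm_nil.

Definition convolution (f g : FQSym K -> FQSym K) (x : FQSym K) : FQSym K :=
  linext (fun st : wperm * wperm => fqmul (f (F st.1)) (g (F st.2)))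
         (fqcomul x).

Definition is_antipode (S : {linear FQSym K -> FQSym K}) : Prop :=
  forall x, convolution S idfun x = fqcounit x *: fqone
         /\ convolution idfun S x = fqcounit x *: fqone.

(* The image of V (x) V in FQSym (x) FQSym. *)
Definition tensor_square (V : FQSym K -> Prop) (z : FQSym2 K) : Prop :=
  exists2 r : seq (FQSym K * FQSym K),
    (forall p, p \in r -> V p.1 /\ V p.2) &
    z = \sum_(p <- r) tensor p.1 p.2.

(* The antipode, being the convolution inverse of the identity, is unique;
   the existential only names the antipode of FQSym. *)
Definition is_hopf_subalgebra (V : FQSym K -> Prop) : Prop :=
  [/\ V 0 /\ (forall (a : K) x y, V x -> V y -> V (a *: x + y)),
      V fqone,
      forall x y, V x -> V y -> V (fqmul x y),
      forall x, V x -> tensor_square V (fqcomul x) &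
      exists2 S : {linear FQSym K -> FQSym K},
        is_antipode S & forall x, V x -> V (S x)].

Definition lin_span (I : Type) (v : I -> FQSym K) (x : FQSym K) : Prop :=
  exists r : seq (K * I), x = \sum_(p <- r) p.1 *: v p.2.

End FQSymStructure.

Inductive bintree (A : Type) : Type :=
| Leaf
| Node of bintree A & A & bintree A.
Arguments Leaf {A}.

Section BintreeEq.
Variable A : eqType.

Fixpoint bintree_eqb (t u : bintree A) : bool :=
  match t, u with
  | Leaf, Leaf => true
  | Node l a r, Node l' a' r' =>
      [&& bintree_eqb l l', a == a' & bintree_eqb r r']
  | _, _ => false
  end.

Lemma bintree_eqP : Equality.axiom bintree_eqb.
Proof.
elim=> [|l IHl a r IHr] [|l' a' r'] /=; try by constructor.
apply: (iffP and3P) => [[/IHl -> /eqP -> /IHr ->] //|[<- <- <-]].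
by split; [apply/IHl | apply: eqxx | apply/IHr].
Qed.

HB.instance Definition _ := hasDecEq.Build (bintree A) bintree_eqP.
End BintreeEq.

Fixpoint nodes (A : Type) (t : bintree A) : nat :=
  if t is Node l _ r then (nodes l + nodes r).+1 else 0%N.

Fixpoint forget (A : Type) (t : bintree A) : bintree unit :=
  if t is Node l _ r then Node (forget l) tt (forget r) else Leaf.

(* The letters 0 and 1 are false and true. The argument d is the letter of
   the leaf when the tree is reduced to a leaf. *)
Fixpoint leaf_word (A : Type) (d : bool) (t : bintree A) : seq bool :=
  if t is Node l _ r then leaf_word true l ++ leaf_word false r else [:: d].

(* The value of d below is irrelevant: for the empty tree its only leaf is
   omitted. *)
Definition canopy (A : Type) (t : bintree A) : seq bool :=
  if leaf_word false t is d :: w then behead (belast d w) else [::].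

Definition is_twin (J : bintree unit * bintree unit) : bool :=
  (nodes J.1 == nodes J.2) &&
  all (fun i => nth false (canopy J.1) i != nth false (canopy J.2) i)
      (iota 0 (nodes J.1).-1).

Definition TBT := {J : bintree unit * bintree unit | is_twin J}.

Fixpoint leaf_insert (a : nat) (t : bintree nat) : bintree nat :=
  if t is Node l b r then
    if (a < b)%N then Node (leaf_insert a l) b r else Node l b (leaf_insert a r)
  else Node Leaf a Leaf.

(* T_{<= a} and T_{> a}; restrict_leP, restrict_gtP and restrict_unique show
   that they are the trees characterized by their nodes and ancestors. *)
Fixpoint restrict_le (a : nat) (t : bintree nat) : bintree nat :=
  if t is Node l b r then
    if (b <= a)%N then Node l b (restrict_le a r) else restrict_le a l
  else Leaf.

Fixpoint restrict_gt (a : nat) (t : bintree nat) : bintree nat :=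
  if t is Node l b r then
    if (a < b)%N then Node (restrict_gt a l) b r else restrict_gt a r
  else Leaf.

Definition root_insert (a : nat) (t : bintree nat) : bintree nat :=
  Node (restrict_le a t) a (restrict_gt a t).

Definition insert_pair (T : bintree nat * bintree nat) (a : nat) :=
  (leaf_insert a T.1, root_insert a T.2).

Definition P_symbol (s : seq nat) : bintree unit * bintree unit :=
  let T := foldl insert_pair (Leaf, Leaf) s in (forget T.1, forget T.2).

Section Restriction.

Fixpoint labels (t : bintree nat) : seq nat :=
  if t is Node l b r then labels l ++ b :: labels r else [::].

Fixpoint is_bst (t : bintree nat) : bool :=
  if t is Node l b r then
    [&& all (fun x => x <= b)%N (labels l), all (fun x => b < x)%N (labels r),
        is_bst l & is_bst r]
  else true.

Fixpoint ancestor (t : bintree nat) (x y : nat) : bool :=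
  if t is Node l b r then
    [|| (x == b) && (y \in labels l ++ labels r),
        ancestor l x y | ancestor r x y]
  else false.

Lemma restrict_leP a t : is_bst t ->
  [/\ is_bst (restrict_le a t),
      labels (restrict_le a t) = [seq x <- labels t | x <= a]%N &
      forall x y, ancestor (restrict_le a t) x y -> ancestor t x y].
Proof.
elim: t => //= l IHl b r IHr /and4P[hl hr bl br].
have [bl' el al] := IHl bl; have [br' er ar] := IHr br.
rewrite filter_cat /=; case: leqP => hb; rewrite ?hb /=.
  split.
  - rewrite hl bl br' !andbT er /=; apply/allP => x.
    by rewrite mem_filter => /andP[_ /(allP hr)].
  - rewrite er; congr (_ ++ _); apply/esym/all_filterP.
    by apply/allP => x /(allP hl) hx; apply: leq_trans hx hb.
  - move=> x y; rewrite er => /or3P[/andP[-> h]|->|/ar ->]; rewrite ?orbT //.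
    suff -> : y \in labels l ++ labels r by [].
    move: h; rewrite !mem_cat mem_filter => /orP[->//|/andP[_ ->]].
    by rewrite orbT.
split=> //; last by move=> x y /al ->; rewrite orbT.
rewrite el [X in _ ++ X](_ : _ = [::]) ?cats0 //.
apply/eqP; rewrite -(negbK (_ == _)) -has_filter; apply/hasPn => x /(allP hr) hx.
by rewrite -ltnNge (ltn_trans hb hx).
Qed.

Lemma restrict_gtP a t : is_bst t ->
  [/\ is_bst (restrict_gt a t),
      labels (restrict_gt a t) = [seq x <- labels t | a < x]%N &
      forall x y, ancestor (restrict_gt a t) x y -> ancestor t x y].
Proof.
elim: t => //= l IHl b r IHr /and4P[hl hr bl br].
have [bl' el al] := IHl bl; have [br' er ar] := IHr br.
rewrite filter_cat /=; case: ltnP => hb; rewrite ?hb /=.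
  split.
  - rewrite hr br bl' !andbT el /=; apply/allP => x.
    by rewrite mem_filter => /andP[_ /(allP hl)].
  - rewrite el; congr (_ ++ _ :: _); apply/esym/all_filterP.
    by apply/allP => x /(allP hr) hx; apply: ltn_trans hb hx.
  - move=> x y; rewrite el => /or3P[/andP[-> h]|/al ->|->]; rewrite ?orbT //.
    suff -> : y \in labels l ++ labels r by [].
    by move: h; rewrite !mem_cat mem_filter => /orP[/andP[_ ->]//|->]; rewrite orbT.
split=> //; last by move=> x y /ar ->; rewrite !orbT.
rewrite er [X in _ = X ++ _](_ : _ = [::]) //.
apply/eqP; rewrite -(negbK (_ == _)) -has_filter; apply/hasPn => x /(allP hl) hx.
by rewrite -leqNgt (leq_trans hx hb).
Qed.

Lemma ancestor_labels t x y :
  ancestor t x y -> (x \in labels t) && (y \in labels t).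
Proof.
elim: t => //= l IHl b r IHr; rewrite !mem_cat !inE.
case/or3P=> [/andP[/eqP -> /orP[->|->]]|/IHl/andP[-> ->]|/IHr/andP[-> ->]];
  by rewrite ?eqxx ?orbT.
Qed.

Lemma ancestor_asym t x y :
  uniq (labels t) -> ancestor t x y -> ~~ ancestor t y x.
Proof.
elim: t x y => //= l IHl b r IHr x y.
rewrite cat_uniq /= negb_or => /and4P[ul /andP[nbl /hasPn dis] nbr ur].
have h (z : nat) : z \in labels l -> z \in labels r -> False.
  by move=> zl /dis; rewrite zl.
have A (z w : nat) : (z == b) && (w \in labels l ++ labels r) ->
    ~~ ancestor l w z && ~~ ancestor r w z && (w != b).
  case/andP=> /eqP-> hw; apply/andP; split; first apply/andP; first split.
  - by apply/negP => /ancestor_labels /andP[_ /(negP nbl)].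
  - by apply/negP => /ancestor_labels /andP[_ /(negP nbr)].
  - by apply: contraL hw => /eqP ->; rewrite mem_cat negb_or nbl nbr.
case/or3P => [H|H|H].
- have /andP[/andP[/negbTE -> /negbTE ->] /negbTE ->] := A _ _ H; by [].
- apply/or3P => -[/A|K|K]; first by rewrite H.
    by have := IHl _ _ ul H; rewrite K.
  have /andP[yr _] := ancestor_labels K.
  by have /andP[_ yl] := ancestor_labels H; apply: (h y).
- apply/or3P => -[/A|K|K]; first by rewrite H andbF.
    have /andP[yl _] := ancestor_labels K.
    by have /andP[_ yr] := ancestor_labels H; apply: (h y).
  by have := IHr _ _ ur H; rewrite K.
Qed.

Lemma bst_sorted t : is_bst t -> sorted leq (labels t).
Proof.
elim: t => //= l IHl b r IHr /and4P[hl hr /IHl sl /IHr sr].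
rewrite sorted_pairwise; last exact: leq_trans.
rewrite pairwise_cat /= -!sorted_pairwise; try exact: leq_trans.
rewrite sl sr !andbT; apply/andP; split; last first.
  by apply/allP => x /(allP hr) /ltnW.
apply/allrelP => x y /(allP hl) hx; rewrite inE => /orP[/eqP -> //|/(allP hr) hy].
exact: leq_trans hx (ltnW hy).
Qed.

Lemma restrict_unique t t1 t2 : uniq (labels t) ->
  is_bst t1 -> is_bst t2 ->
  uniq (labels t1) -> perm_eq (labels t1) (labels t2) ->
  (forall x y, ancestor t1 x y -> ancestor t x y) ->
  (forall x y, ancestor t2 x y -> ancestor t x y) ->
  t1 = t2.
Proof.
move=> ut b1 b2 u1 p12.
have {p12} e12 : labels t1 = labels t2.
  apply: (sorted_eq leq_trans anti_leq) => //; exact: bst_sorted.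
elim: t1 t2 b1 b2 u1 e12 => [|l1 IHl a1 r1 IHr] [|l2 a2 r2] //=.
- by move=> _ _ _ /(congr1 size); rewrite size_cat /= addnS.
- by move=> _ _ _ /(congr1 size); rewrite size_cat /= addnS.
move=> /and4P[_ _ bl1 br1] /and4P[_ _ bl2 br2] u1 e12 A1 A2.
have ea : a1 = a2.
  apply/eqP; apply: contraT => ne.
  have m1 : a2 \in labels l1 ++ labels r1.
    have : a2 \in labels l1 ++ a1 :: labels r1.
      by rewrite e12 mem_cat inE eqxx orbT.
    by rewrite !mem_cat inE [a2 == a1]eq_sym (negbTE ne).
  have m2 : a1 \in labels l2 ++ labels r2.
    have : a1 \in labels l2 ++ a2 :: labels r2.
      by rewrite -e12 mem_cat inE eqxx orbT.
    by rewrite !mem_cat inE (negbTE ne).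
  have H1 : ancestor t a1 a2 by apply: A1; rewrite eqxx m1.
  have H2 : ancestor t a2 a1 by apply: A2; rewrite eqxx m2.
  by have := ancestor_asym ut H1; rewrite H2.
rewrite -ea in e12 A2 *; clear a2 ea.
have idx (w1 w2 : seq nat) : uniq (w1 ++ a1 :: w2) ->
    index a1 (w1 ++ a1 :: w2) = size w1.
  rewrite cat_uniq /= negb_or => /and3P[_ /andP[na _] _].
  by rewrite index_cat (negbTE na) /= eqxx addn0.
have es : size (labels l1) = size (labels l2).
  by rewrite -(idx _ _ u1) e12 idx // -e12.
move/eqP: e12; rewrite eqseq_cat // => /andP[/eqP el /eqP [er]].
move: u1; rewrite cat_uniq => /= /and3P[ul _ /andP[_ ur]].
congr (Node _ _ _).
  by apply: IHl => // x y h; [apply: A1 | apply: A2]; rewrite h !orbT.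
by apply: IHr => // x y h; [apply: A1 | apply: A2]; rewrite h !orbT.
Qed.

End Restriction.

Definition wperms (n : nat) : seq wperm :=
  pmap insub (permutations (iota 1 n)).

(* P_symbol s has as many nodes as s has letters, so the sum over all
   permutations reduces to the following finite sum, see mcoeff_PJ. *)
Definition PJ (K : fieldType) (J : TBT) : FQSym K :=
  (\sum_(s <- wperms (nodes (val J).1) | P_symbol s == val J) F K s)%R.

Lemma nodes_P_symbol s : nodes (P_symbol s).1 = size s.
Proof.
rewrite /P_symbol /=.
have nf (A : Type) (t : bintree A) : nodes (forget t) = nodes t.
  by elim: t => //= l -> _ r ->.
have nl a t : nodes (leaf_insert a t) = (nodes t).+1.
  by elim: t => //= l IHl b r IHr; case: ifP => _ /=; rewrite ?IHl ?IHr ?addnS.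
rewrite nf -[RHS]/(nodes (Leaf : bintree nat, Leaf : bintree nat).1 + size s)%N.
by elim: s (Leaf, Leaf) => [|a s IHs] T /=; rewrite ?addn0 // IHs nl addnS.
Qed.

Lemma mem_wperms n (s : wperm) : (s \in wperms n) = (size s == n).
Proof.
rewrite mem_pmap_sub mem_permutations; case: s => w pw /=.
apply/idP/eqP => [/perm_size|<- //]; by rewrite size_iota.
Qed.

Lemma mcoeff_PJ (K : fieldType) (J : TBT) (s : wperm) :
  (PJ K J)@_s = ((P_symbol s == val J)%:R)%R.
Proof.
have uq : uniq (wperms (nodes (val J).1)).
  apply: pmap_sub_uniq; exact: permutations_uniq.
rewrite /PJ raddf_sum /= -big_filter.
under eq_bigr do rewrite /F mcoeffU.
case: eqP => e; last first.
  rewrite big_seq big1 // => t; rewrite mem_filter => /andP[/eqP et _].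
  by case: eqP => // ets; rewrite ets in et.
have sin : s \in [seq t : wperm <- wperms (nodes (val J).1) | P_symbol t == val J].
  rewrite mem_filter mem_wperms; apply/andP; split; first exact/eqP.
  by rewrite -(nodes_P_symbol s) e.
rewrite (bigD1_seq s) ?filter_uniq //= eqxx big1 ?addr0 // => t /negbTE ->.
by [].
Qed.

(* Main.v *)
From HB Require Import structures.
Require Import Defs.
From mathcomp Require Import all_boot all_order all_algebra.
From mathcomp Require Import finmap monalg.

(** Call two permutations equivalent when they have the same image under
[P_symbol]. Every [P_symbol s] is a pair of twin trees ([P_symbol_twin]), so
the span of the [P_J] is the space of all [x] in FQSym whose coefficients are
constant on equivalence classes ([lin_span_PJP]). It remains to see that the
operations of FQSym preserve these class functions, and this only uses how the
two trees react to elementary operations on words.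

On words without repeated letters, a root insertion of the letters from left
to right builds the same tree as a leaf insertion from right to left, so
[P_symbol u] is the pair of shapes of the search trees of [u] and of [rev u]
([P_symbolE]). When the set of letters is known, the shape of a search tree
determines its labels, hence the labelled trees themselves. The search tree of
[u] obeys the quicksort recursion ([bst_cons]), from which it follows that
- the tree of the restriction of [u] to an initial or a final interval of
  letters is a function of the tree of [u] ([bst_filter_le], [bst_filter_gt]);
- the tree of [u ++ v] is a function of the trees of [u] and [v] ([bst_cat]);
- an increasing relabelling does not change the shape ([forget_bst_map]), so
  standardization does not change [P_symbol] ([P_symbol_std]).

The coefficient of [F_p] in [x * y] is the sum over [n] of
[x@_(p restricted to letters <= n) * y@_(std of p restricted to letters > n)]
([mcoeff_fqmul]); the first and third facts make it invariant under
equivalence. The coefficient of [F_s (x) F_t] in the coproduct of [x] is the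
sum of [x@_p] over the [p] whose prefix and suffix standardize to [s] and [t];
changing [s] and [t] within their classes rearranges the prefix and the suffix
of each such [p] in place, which by the second fact gives an equivalent
permutation and a bijection between the two index sets
([mcoeff_fqcomul_class]). A function on pairs that is invariant in both
arguments is a combination of tensors of [P_J] ([class_function_decomp]).

The antipode is the series of convolution powers
[S = sum_k (-1)^k (id - unit o counit)^k], which is finite in each degree.
Its truncations are obtained from the identity by convolutions and differences
of maps that preserve class functions, so [S] does too. *)

Set Implicit Arguments.
Unset Strict Implicit.
Unset Printing Implicit Defensive.

Import GRing.Theory.

(** * Search trees of words *)

Definition bst (w : seq nat) : bintree nat :=
  foldl (fun t a => leaf_insert a t) Leaf w.

Lemma foldl_leaf_insert_Node l b r v :
  foldl (fun t a => leaf_insert a t) (Node l b r) v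
  = Node (foldl (fun t a => leaf_insert a t) l [seq x <- v | x < b]) b
         (foldl (fun t a => leaf_insert a t) r [seq x <- v | b <= x]).
Proof. by elim: v l r => //= a v IHv l r; case: ltnP => _; rewrite IHv. Qed.

Lemma bst_cons a w :
  bst (a :: w) = Node (bst [seq x <- w | x < a]) a (bst [seq x <- w | a <= x]).
Proof. exact: foldl_leaf_insert_Node. Qed.

(** Induction along the recursion of [bst_cons]. *)
Lemma quicksort_ind (Q : seq nat -> Prop) :
  Q [::] ->
  (forall a w, Q [seq x <- w | x < a] -> Q [seq x <- w | a <= x] ->
     Q (a :: w)) ->
  forall w, Q w.
Proof.
move=> Q0 QS w; have [n] := ubnP (size w); elim: n w => // n IHn [|a w] //=.
by rewrite ltnS => hw; apply: QS; apply: IHn;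
  apply: leq_ltn_trans hw; rewrite size_filter count_size.
Qed.

Lemma bst_filter_le a w :
  bst [seq x <- w | x <= a] = restrict_le a (bst w).
Proof.
elim/quicksort_ind: w => // b w IHl IHr; rewrite bst_cons /=.
case: leqP => [ba|ab]; rewrite ?bst_cons -?IHl -?IHr -!filter_predI.
  congr (Node (bst _) _ (bst _)); apply: eq_filter => x /=.
    by case: (ltnP x b) => // xb; rewrite (leq_trans (ltnW xb)).
  by rewrite andbC.
congr bst; apply: eq_filter => x /=.
by case: (leqP x a) => // xa; rewrite (leq_ltn_trans xa ab).
Qed.

Lemma bst_filter_gt a w :
  bst [seq x <- w | a < x] = restrict_gt a (bst w).
Proof.
elim/quicksort_ind: w => // b w IHl IHr; rewrite bst_cons /=.
case: ltnP => [ab|ba]; rewrite ?bst_cons -?IHl -?IHr -!filter_predI.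
  congr (Node (bst _) _ (bst _)); apply: eq_filter => x /=.
    by rewrite andbC.
  by case: (leqP b x) => // bx; rewrite (leq_trans ab bx).
congr bst; apply: eq_filter => x /=.
by case: (ltnP a x) => // ax; rewrite (ltnW (leq_ltn_trans ba ax)).
Qed.

(** Inserting [v] into a tree hangs the trees of interval restrictions of [v] on
its leaves, and these restrictions only depend on the tree of [v]. *)
Lemma bst_cat u v u' v' :
  bst u = bst u' -> bst v = bst v' -> bst (u ++ v) = bst (u' ++ v').
Proof.
move=> eu ev; rewrite /bst !foldl_cat -!/(bst _) -eu; move: (bst u) => {u u' eu} t.
elim: t v v' ev => [|l IHl b r IHr] v v' ev; first exact: ev.
rewrite !foldl_leaf_insert_Node; congr Node; [apply: IHl|apply: IHr].
  case: b => [|b]; first by rewrite !(@eq_filter _ _ pred0) ?filter_pred0.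
  by rewrite !bst_filter_le ev.
case: b => [|b]; last by rewrite !bst_filter_gt ev.
by rewrite !(@eq_filter _ _ predT) ?filter_predT.
Qed.

Lemma perm_labels_bst w : perm_eq (labels (bst w)) w.
Proof.
elim/quicksort_ind: w => // a w IHl IHr; rewrite bst_cons /=.
rewrite perm_catC /= perm_cons perm_catC.
rewrite perm_sym -(perm_filterC (fun x => x < a) w) perm_sym.
apply: perm_cat => //.
rewrite [X in perm_eq _ X](_ : _ = [seq x <- w | a <= x]) //.
by apply: eq_filter => x /=; rewrite -leqNgt.
Qed.

Lemma sorted_labels_bst w : sorted leq (labels (bst w)).
Proof.
elim/quicksort_ind: w => // a w IHl IHr; rewrite bst_cons /=.
rewrite (sorted_pairwise leq_trans) pairwise_cat /=.
rewrite -!(sorted_pairwise leq_trans) IHl IHr !andbT.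
have hl x : x \in labels (bst [seq x <- w | x < a]) -> x <= a.
  by rewrite (perm_mem (perm_labels_bst _)) mem_filter => /andP[/ltnW].
have hr : all (leq a) (labels (bst [seq x <- w | a <= x])).
  apply/allP => x.
  by rewrite (perm_mem (perm_labels_bst _)) mem_filter => /andP[].
rewrite hr !andbT; apply/allrelP => x y /hl xa; rewrite inE => /predU1P[-> //|].
by move/(allP hr); apply: leq_trans.
Qed.

Lemma labels_bst w : labels (bst w) = sort leq w.
Proof.
apply: (sorted_eq leq_trans anti_leq); first exact: sorted_labels_bst.
  exact/sort_sorted/leq_total.
by rewrite perm_sym perm_sort perm_sym perm_labels_bst.
Qed.

(** The sequence of labels is read in infix order, so a shape and its label word
leave no freedom. *)
Lemma bintree_eq_forget (t u : bintree nat) :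
  forget t = forget u -> labels t = labels u -> t = u.
Proof.
have sz (v : bintree nat) : size (labels v) = nodes (forget v).
  by elim: v => //= l IHl b r IHr; rewrite size_cat /= IHl IHr addnS.
elim: t u => [|l IHl b r IHr] [|l' b' r'] //= [el er] /eqP.
rewrite eqseq_cat ?sz ?el // => /andP[/eqP hl /eqP [-> hr]].
by congr Node; [apply: IHl | apply: IHr].
Qed.

Lemma forget_bst_map f w : {in w &, {mono f : x y / x <= y}} ->
  forget (bst (map f w)) = forget (bst w).
Proof.
elim/quicksort_ind: w => // a w IHl IHr fm; rewrite map_cons !bst_cons /=.
have sub p x : x \in filter p w -> x \in a :: w.
  by rewrite mem_filter inE => /andP[_ ->]; rewrite orbT.
rewrite -IHl; last by move=> x y /sub hx /sub; apply: fm.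
rewrite -IHr; last by move=> x y /sub hx /sub; apply: fm.
rewrite !filter_map; congr Node; congr (forget (bst (map _ _)));
  apply: eq_in_filter => x xw /=.
  by rewrite !ltnNge fm ?inE ?eqxx ?xw ?orbT.
by rewrite fm ?inE ?eqxx ?xw ?orbT.
Qed.

(** The root of the search tree of [rev u] is the last letter of [u], and its
subtrees come from the restrictions of [u] below and above that letter: this is
what a root insertion of the last letter produces, by [bst_filter_le] and
[bst_filter_gt]. *)
Lemma P_symbolE u : uniq u ->
  P_symbol u = (forget (bst u), forget (bst (rev u))).
Proof.
move=> uu; suff -> : P_symbol u = (forget (bst u),
    forget (foldl (fun t a => root_insert a t) Leaf u)).
  congr (_, forget _); elim/last_ind: u uu => // u a IHu.
  rewrite rcons_uniq foldl_rcons rev_rcons bst_cons => /andP[au /IHu ->].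
  rewrite /root_insert -bst_filter_le -bst_filter_gt.
  congr (Node (bst _) _ (bst _)); apply: eq_in_filter => x; rewrite mem_rev => xu;
    have /negbTE xa : x != a by apply: contraNneq au => <-.
    by rewrite [LHS]leq_eqVlt xa.
  by rewrite [RHS]leq_eqVlt eq_sym xa.
rewrite /P_symbol /bst.
have -> t1 t2 : foldl insert_pair (t1, t2) u
    = (foldl (fun t a => leaf_insert a t) t1 u,
       foldl (fun t a => root_insert a t) t2 u).
  by elim: u {uu} t1 t2 => //= a u IHu t1 t2; rewrite IHu.
by [].
Qed.

Lemma P_symbol_bst u v : uniq u -> perm_eq u v -> P_symbol u = P_symbol v ->
  bst u = bst v /\ bst (rev u) = bst (rev v).
Proof.
move=> uu uv; have uv' : uniq v by rewrite -(perm_uniq uv).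
rewrite !P_symbolE // => -[e1 e2].
have srt w w' : perm_eq w w' -> sort leq w = sort leq w'.
  by move/(perm_sortP leq_total leq_trans anti_leq).
split; apply: bintree_eq_forget => //; rewrite !labels_bst; apply: srt => //.
by rewrite perm_rev perm_sym perm_rev perm_sym.
Qed.

Lemma P_symbol_map f u : {in u &, {mono f : x y / x <= y}} -> uniq u ->
  P_symbol (map f u) = P_symbol u.
Proof.
move=> fm uu; have um : uniq (map f u).
  rewrite map_inj_in_uniq // => x y xu yu e.
  by apply: anti_leq; rewrite -fm // -[y <= x]fm // e leqnn.
rewrite !P_symbolE // -map_rev !forget_bst_map //.
by move=> x y; rewrite !mem_rev; apply: fm.
Qed.

(** * Twin canopies *)

(** The leaf between two letters that are consecutive in the infix order hangs
below the one inserted last, so its orientation records which of the two comes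
first in the word. The relation [r] encodes the order of appearance in [w];
[x] and [y] stand for the letters surrounding those of [w], assumed to appear
earlier, as the ancestors of a subtree do. *)
Lemma leaf_word_bst (r : rel nat) w x y :
  pairwise (fun u v => r u v && ~~ r v u) w ->
  all (r x) w -> all (fun z => ~~ r z y) w ->
  leaf_word (r x y) (bst w) = pairmap r x (rcons (labels (bst w)) y).
Proof.
elim/quicksort_ind: w x y => //= a w IHl IHr x y /andP[aw pw].
case/andP=> xa xw /andP[ay yw]; rewrite bst_cons /= -cats1 -catA cat_cons.
rewrite -cat_rcons pairmap_cat cats1 last_rcons.
have sub p : subseq (filter p w) w by apply: filter_subseq.
have hf p (q : pred nat) : all q w -> all q (filter p w).
  by move/allP=> hq; apply/allP => z /(mem_subseq (sub p)) /hq.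
have [ra ar] : all (r a) w /\ all (fun z => ~~ r z a) w.
  by split; apply/allP => z /(allP aw) /andP[].
rewrite -IHl -?IHr ?hf //; try exact: subseq_pairwise (sub _) pw.
by rewrite xa (negbTE ay).
Qed.

Lemma canopy_forget (t : bintree nat) : canopy (forget t) = canopy t.
Proof.
have h d : leaf_word d (forget t) = leaf_word d t.
  by elim: t d => //= l IHl b r IHr d; rewrite IHl IHr.
by rewrite /canopy h.
Qed.

Lemma canopy_bst (r : rel nat) w x y :
  pairwise (fun u v => r u v && ~~ r v u) w ->
  all (r x) w -> all (fun z => ~~ r z y) w ->
  canopy (bst w) = behead (pairmap r x (sort leq w)).
Proof.
move=> pw xw wy; have := leaf_word_bst pw xw wy; rewrite -labels_bst /canopy.
case: w {pw xw wy} => [//|a w]; rewrite bst_cons /= => ->.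
case: (labels _ ++ _) => [|b s] //=.
by rewrite -cats1 pairmap_cat cats1 belast_rcons.
Qed.

Lemma perm_wperm (s : wperm) : perm_eq s (iota 1 (size s)).
Proof. by case: s. Qed.

Lemma mem_wperm (s : wperm) x : (x \in val s) = (0 < x <= size s).
Proof. by rewrite (perm_mem (perm_wperm s)) mem_iota add1n ltnS. Qed.

Lemma sort_wperm (s : wperm) : sort leq s = iota 1 (size s).
Proof.
apply: (sorted_eq leq_trans anti_leq).
- exact/sort_sorted/leq_total.
- exact: iota_sorted.
- by rewrite perm_sort perm_wperm.
Qed.

Lemma pairwise_rev (T : Type) (r : rel T) (w : seq T) :
  pairwise r (rev w) = pairwise (fun x y => r y x) w.
Proof.
by elim: w => //= x w IHw; rewrite rev_cons pairwise_rcons all_rev IHw.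
Qed.

(** Reversing the word exchanges before and after, hence complements the
canopy. *)
Lemma P_symbol_twin (s : wperm) : is_twin (P_symbol s).
Proof.
have us := uniq_wperm s; rewrite P_symbolE // /is_twin /= !canopy_forget.
have sz w : nodes (forget (bst w)) = size w.
  rewrite -(perm_size (perm_labels_bst w)).
  by elim: (bst w) => //= l IHl b r IHr; rewrite size_cat /= IHl IHr addnS.
rewrite !sz size_rev eqxx /=.
have s0 : 0 \notin val s by rewrite mem_wperm.
have sn : (size s).+1 \notin val s by rewrite mem_wperm ltnn andbF.
(* The same comparison [r], complemented, serves for [rev s]: 0 is put in front
   of [s] as the earliest letter, and the absent letter [(size s).+1], whose
   index is the length, is the latest one, i.e. the earliest in reverse. *)
pose r u v := index u (0 :: s) < index v (0 :: s).
have pr : pairwise (fun u v => r u v && ~~ r v u) s.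
  apply/(pairwiseP 0) => i j; rewrite !inE => hi hj ij.
  have us0 : uniq (0 :: s) by rewrite /= s0.
  have nthS k : nth 0 s k = nth 0 (0 :: s) k.+1 by [].
  by rewrite /r !nthS !index_uniq //= !ltnS ij -leqNgt ltnW.
have z0 z : z \in val s -> (0 == z) = false.
  by move=> zs; apply/eqP => e; rewrite -e (negbTE s0) in zs.
have r0 z : z \in val s -> r 0 z by move=> zs; rewrite /r /= z0.
have rn z : z \in val s -> r z (size s).+1.
  by move=> zs; rewrite /r /= z0 // ltnS (memNindex sn) index_mem.
rewrite (@canopy_bst r s 0 0) //; first last.
- by apply/allP => z /r0; rewrite /r -leqNgt => /ltnW.
- exact/allP.
rewrite (@canopy_bst (fun u v => ~~ r u v) (rev s) (size s).+1 (size s).+1).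
- rewrite (_ : sort leq (rev s) = sort leq s); last first.
    by apply/(perm_sortP leq_total leq_trans anti_leq); rewrite perm_rev.
  rewrite sort_wperm; apply/allP => i.
  case: (size s) => [|n] //; rewrite mem_iota add0n /= => hi.
  by rewrite !(nth_pairmap 0) ?size_iota //; case: (r _ _).
- rewrite pairwise_rev; apply: sub_pairwise pr => u v /andP[uv vu].
  by rewrite negbK uv vu.
- by apply/allP => z; rewrite mem_rev => /rn; rewrite /r -leqNgt => /ltnW.
- by apply/allP => z; rewrite mem_rev negbK => /rn.
Qed.

(** * Standardization *)

Lemma std_eq (u v : seq nat) : size u = size v ->
  (forall i j, i < j < size u ->
     (nth 0 u i <= nth 0 u j) = (nth 0 v i <= nth 0 v j)) ->
  std u = std v.
Proof.
move=> suv h; apply: std_unique => [|i j ij]; first by rewrite size_std_word.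
by rewrite -suv in ij; rewrite std_word_ltE // h // -?suv.
Qed.

Lemma std_wperm (s : wperm) : std s = s.
Proof.
apply/esym/std_unique => // i j /andP[ij js]; rewrite [RHS]leq_eqVlt.
by rewrite nth_uniq ?uniq_wperm ?(ltn_trans ij) // (ltn_eqF ij).
Qed.

Lemma std_map f u : {in u &, {mono f : x y / x <= y}} -> std (map f u) = std u.
Proof.
move=> fm; apply: std_eq; rewrite size_map // => i j /andP[ij ju].
have iu := ltn_trans ij ju.
by rewrite !(nth_map 0) // fm // mem_nth.
Qed.

Lemma index_sort_mono u : uniq u ->
  {in u &, {mono (index^~ (sort leq u)) : x y / x <= y}}.
Proof.
move=> uu x y xu yu; have sl := sort_sorted leq_total u.
rewrite -(mem_sort leq) in xu; rewrite -(mem_sort leq) in yu.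
apply/idP/idP; first exact: (sorted_leq_index leq_trans leqnn sl).
move=> xy; rewrite leqNgt; apply/negP => lt.
have e : x = y.
  by apply: anti_leq; rewrite xy (sorted_ltn_index leq_trans sl y x yu xu lt).
by rewrite e ltnn in lt.
Qed.

(** Since [std] depends only on comparisons, standardizing amounts to replacing
each letter by its rank, an increasing relabelling. *)
Lemma stdE u : uniq u ->
  std u = [seq (index x (sort leq u)).+1 | x <- u] :> seq nat.
Proof.
move=> uu; have us : uniq (sort leq u) by rewrite sort_uniq.
set v := map _ _; have pv : perm_eq v (iota 1 (size v)).
  rewrite (perm_trans (y := [seq (index x (sort leq u)).+1 | x <- sort leq u])) //.
    by rewrite perm_map // perm_sym perm_sort.
  suff -> : [seq (index x (sort leq u)).+1 | x <- sort leq u] = iota 1 (size v) by [].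
  rewrite size_map -(size_sort leq u); apply: (@eq_from_nth _ 0).
    by rewrite size_map size_iota.
  move=> i; rewrite size_map => hi.
  by rewrite (nth_map 0) // nth_iota // index_uniq.
rewrite -[RHS]/(val (WPerm pv)); congr val; rewrite -[RHS]std_wperm.
apply/esym/std_map => x y xu yu.
by rewrite ltnS index_sort_mono.
Qed.

Lemma P_symbol_std u : uniq u -> P_symbol (std u) = P_symbol u.
Proof.
move=> uu; rewrite stdE // P_symbol_map // => x y xu yu.
by rewrite ltnS index_sort_mono.
Qed.

Lemma std_take_std i u : uniq u -> std (take i (std u)) = std (take i u).
Proof.
move=> uu; rewrite stdE // -map_take std_map // => x y /mem_take xu /mem_take yu.
by rewrite ltnS index_sort_mono.
Qed.

Lemma std_drop_std i u : uniq u -> std (drop i (std u)) = std (drop i u).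
Proof.
move=> uu; rewrite stdE // -map_drop std_map // => x y /mem_drop xu /mem_drop yu.
by rewrite ltnS index_sort_mono.
Qed.

(** * Operations compatible with the P-symbol *)

Lemma P_symbol_perm (s t : wperm) : P_symbol s = P_symbol t -> perm_eq s t.
Proof.
move=> e; have sz : size s = size t by rewrite -!nodes_P_symbol e.
by rewrite (permPl (perm_wperm s)) sz perm_sym perm_wperm.
Qed.

Lemma P_symbol_filter_le n (s t : wperm) : P_symbol s = P_symbol t ->
  P_symbol [seq x <- s | x <= n] = P_symbol [seq x <- t | x <= n].
Proof.
move=> e; have [e1 e2] := P_symbol_bst (uniq_wperm s) (P_symbol_perm e) e.
rewrite !P_symbolE ?filter_uniq ?uniq_wperm // -!filter_rev.
by rewrite !bst_filter_le e1 e2.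
Qed.

Lemma P_symbol_filter_gt n (s t : wperm) : P_symbol s = P_symbol t ->
  P_symbol [seq x <- s | n < x] = P_symbol [seq x <- t | n < x].
Proof.
move=> e; have [e1 e2] := P_symbol_bst (uniq_wperm s) (P_symbol_perm e) e.
rewrite !P_symbolE ?filter_uniq ?uniq_wperm // -!filter_rev.
by rewrite !bst_filter_gt e1 e2.
Qed.

Lemma P_symbol_cat u v u' v' : uniq (u ++ v) ->
  perm_eq u u' -> perm_eq v v' ->
  P_symbol u = P_symbol u' -> P_symbol v = P_symbol v' ->
  P_symbol (u ++ v) = P_symbol (u' ++ v').
Proof.
move=> uuv pu pv eu ev; have uuv' : uniq (u' ++ v').
  by rewrite -(perm_uniq (perm_cat pu pv)).
move: (uuv); rewrite cat_uniq => /and3P[uu _ uv].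
have [eu1 eu2] := P_symbol_bst uu pu eu.
have [ev1 ev2] := P_symbol_bst uv pv ev.
by rewrite !P_symbolE // !rev_cat (bst_cat eu1 ev1) (bst_cat ev2 eu2).
Qed.

(** * Recovering a permutation from its standardized factors *)

Definition relabel (I : seq nat) (s : seq nat) := [seq nth 0 I x.-1 | x <- s].

Section Relabel.
Variables (I : seq nat) (s : wperm).
Hypotheses (sI : sorted ltn I) (szI : size I = size s).

Lemma relabel_mono :
  {in val s &, {mono (fun x => nth 0 I x.-1) : x y / x <= y}}.
Proof.
move=> x y; rewrite !mem_wperm -szI => /andP[x0 xI] /andP[y0 yI].
have h := leq_mono_in (sorted_ltn_nth ltn_trans 0 sI).
by rewrite h ?inE ?prednK // -[LHS]ltnS !prednK.
Qed.

Lemma perm_relabel : perm_eq (relabel I s) I.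
Proof.
apply: (perm_trans (perm_map _ (perm_wperm s))).
rewrite (iotaDl 1 0) -map_comp -szI.
have -> : map ((fun x => nth 0 I x.-1) \o addn 1) (iota 0 (size I)) = I.
  exact: (mkseq_nth 0 I).
by [].
Qed.

Lemma std_relabel : std (relabel I s) = s.
Proof. by rewrite (std_map relabel_mono) std_wperm. Qed.

Lemma P_symbol_relabel : P_symbol (relabel I s) = P_symbol s.
Proof. by rewrite (P_symbol_map relabel_mono) // uniq_wperm. Qed.

Lemma sort_relabel : sort leq (relabel I s) = I.
Proof.
move: sI; rewrite ltn_sorted_uniq_leq => /andP[_ sI'].
apply: (sorted_eq leq_trans anti_leq) => //; first exact/sort_sorted/leq_total.
by rewrite perm_sort perm_relabel.
Qed.
End Relabel.

(** [relabel], applied to the increasing word of the letters, inverts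
standardization. *)
Lemma relabel_std u : uniq u -> relabel (sort leq u) (std u) = u.
Proof.
move=> uu; rewrite /relabel stdE // -map_comp map_id_in // => x xu /=.
by rewrite nth_index // mem_sort.
Qed.

Lemma sorted_ltn_sort u : uniq u -> sorted ltn (sort leq u).
Proof.
by move=> uu; rewrite ltn_sorted_uniq_leq sort_uniq uu; apply/sort_sorted/leq_total.
Qed.

Lemma std_val w : perm_eq w (iota 1 (size w)) -> std w = w :> seq nat.
Proof. by move=> pw; rewrite -[w]/(val (WPerm pw)) std_wperm. Qed.

(** The permutation with the same sets of letters as [p] in its prefix of length
[size s] and in the remaining suffix, arranged there like [s] and [t]. The
concatenation is already a permutation ([reassembleE]); [std] only gives it
the type [wperm]. *)
Definition reassemble (s t p : wperm) : wperm :=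
  std (relabel (sort leq (take (size s) p)) s
       ++ relabel (sort leq (drop (size s) p)) t).

Section Reassemble.
Variables (s t p : wperm).
Hypothesis szp : size p = (size s + size t)%N.

Let ut : uniq (take (size s) p).
Proof. exact: take_uniq (uniq_wperm p). Qed.
Let ud : uniq (drop (size s) p).
Proof. exact: drop_uniq (uniq_wperm p). Qed.
Let szt : size (sort leq (take (size s) p)) = size s.
Proof. by rewrite size_sort size_take szp; case: ltngtP (leq_addr (size t) (size s)). Qed.
Let szd : size (sort leq (drop (size s) p)) = size t.
Proof. by rewrite size_sort size_drop szp addKn. Qed.
Let st := sorted_ltn_sort ut.
Let sd := sorted_ltn_sort ud.

Lemma reassembleE : reassemble s t p
  = relabel (sort leq (take (size s) p)) s
    ++ relabel (sort leq (drop (size s) p)) t :> seq nat.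
Proof.
have h : perm_eq (relabel (sort leq (take (size s) p)) s
    ++ relabel (sort leq (drop (size s) p)) t) p.
  rewrite -[val p in X in perm_eq _ X](cat_take_drop (size s)).
  apply: perm_cat; first by rewrite (permPl (perm_relabel szt)) perm_sort.
  by rewrite (permPl (perm_relabel szd)) perm_sort.
by apply: std_val; rewrite (permPl h) (perm_size h) perm_wperm.
Qed.

Let szr : size (relabel (sort leq (take (size s) p)) s) = size s.
Proof. by rewrite size_map. Qed.

Lemma size_reassemble : size (reassemble s t p) = (size s + size t)%N.
Proof. by rewrite reassembleE size_cat !size_map. Qed.

Lemma std_take_reassemble : std (take (size s) (reassemble s t p)) = s.
Proof. by rewrite reassembleE (take_size_cat _ szr) std_relabel. Qed.

Lemma std_drop_reassemble : std (drop (size s) (reassemble s t p)) = t.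
Proof. by rewrite reassembleE (drop_size_cat _ szr) std_relabel. Qed.

Lemma reassembleK (s' t' : wperm) :
  size s' = size s -> std (take (size s') p) = s' -> std (drop (size s') p) = t' ->
  reassemble s' t' (reassemble s t p) = p.
Proof.
move=> sz es et; rewrite {1}/reassemble reassembleE sz.
rewrite (take_size_cat _ szr) (drop_size_cat _ szr) !sort_relabel //.
by rewrite -es -et sz !relabel_std // cat_take_drop std_wperm.
Qed.

Lemma P_symbol_reassemble :
  P_symbol s = P_symbol (std (take (size s) p)) ->
  P_symbol t = P_symbol (std (drop (size s) p)) ->
  P_symbol (reassemble s t p) = P_symbol p.
Proof.
move=> es et; rewrite -[in RHS](cat_take_drop (size s) (val p)).
rewrite reassembleE; apply: P_symbol_cat.
- by rewrite -reassembleE uniq_wperm.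
- by rewrite (permPl (perm_relabel szt)) perm_sort.
- by rewrite (permPl (perm_relabel szd)) perm_sort.
- by rewrite P_symbol_relabel // es P_symbol_std.
- by rewrite P_symbol_relabel // et P_symbol_std.
Qed.

End Reassemble.

(** * Shifted shuffles *)

Lemma shuffle_nil u : shuffle u [::] = [:: u].
Proof. by case: u. Qed.

Lemma filter_shuffle (a : pred nat) u v w :
  all a u -> all (predC a) v -> w \in shuffle u v ->
  filter a w = u /\ filter (predC a) w = v.
Proof.
have nilE (b : pred nat) x : all (predC b) x -> filter b x = [::].
  by rewrite all_predC => bx; apply/eqP; rewrite -(negbK (_ == _)) -has_filter.
have allE (b : pred nat) x : all b x -> filter b x = x by move/all_filterP.
have nilC x : all a x -> filter (predC a) x = [::].
  by move=> ax; apply: nilE; apply: sub_all ax => y /= ->.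
elim: u v w => [|b u IHu] v w au; first by rewrite inE => av /eqP ->; rewrite nilE ?allE.
elim: v w => [|d v IHv] w av; first by rewrite inE => /eqP ->; rewrite nilC ?allE.
case/andP: (au) => ab au'; case/andP: (av) => ad av'.
rewrite mem_cat => /orP[] /mapP[w' hw' ->] /=.
  by rewrite ab; have [-> ->] := IHu _ _ au' av hw'.
by move: ad => /= /[dup] /negbTE -> ->; have [-> ->] := IHv _ av' hw'.
Qed.

Lemma mem_shuffle_filter (a : pred nat) w :
  w \in shuffle (filter a w) (filter (predC a) w).
Proof.
elim: w => [|c w IHw]; first by rewrite inE.
rewrite /=; case: (a c) => /=.
  case e : (filter (predC a) w) => [|d v].
    by move: IHw; rewrite e shuffle_nil !inE eqseq_cons eqxx.
  by rewrite mem_cat map_f // -e.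
case e : (filter a w) => [|d u].
  by move: IHw; rewrite e !inE eqseq_cons eqxx.
rewrite e in IHw; rewrite mem_cat; apply/orP; right.
exact: (map_f (cons c)).
Qed.

Lemma filter_iota n N : n <= N ->
  [seq x <- iota 1 N | x <= n] = iota 1 n
  /\ [seq x <- iota 1 N | n < x] = iota n.+1 (N - n).
Proof.
move=> nN; rewrite -{1 2}(subnKC nN) iotaD !filter_cat.
have all1 : all (fun x => x <= n) (iota 1 n).
  by apply/allP => x; rewrite mem_iota add1n ltnS => /andP[].
have all2 : all (fun x => n < x) (iota (1 + n) (N - n)).
  by apply/allP => x; rewrite mem_iota => /andP[].
have -> : [seq x <- iota 1 n | n < x] = [::].
  rewrite -(filter_pred0 (iota 1 n)); apply: eq_in_filter => x /(allP all1).
  by rewrite leqNgt => /negbTE.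
have -> : [seq x <- iota (1 + n) (N - n) | x <= n] = [::].
  rewrite -(filter_pred0 (iota (1 + n) (N - n))).
  by apply: eq_in_filter => x /(allP all2); rewrite ltnNge => /negbTE.
by rewrite (all_filterP all1) (all_filterP all2) cats0.
Qed.

Section FilterPerm.
Variables (p : wperm) (n : nat).
Hypothesis np : n <= size p.

Lemma perm_filter_le : perm_eq [seq x <- p | x <= n] (iota 1 n).
Proof. by rewrite -(filter_iota np).1; apply: perm_filter; apply: perm_wperm. Qed.

Lemma perm_filter_gt : perm_eq [seq x <- p | n < x] (iota n.+1 (size p - n)).
Proof. by rewrite -(filter_iota np).2; apply: perm_filter; apply: perm_wperm. Qed.

Lemma std_filter_le : std [seq x <- p | x <= n] = [seq x <- p | x <= n] :> seq nat.
Proof.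
apply: std_val; apply: (perm_trans perm_filter_le).
by rewrite (perm_size perm_filter_le) size_iota.
Qed.

Lemma std_filter_gt :
  map (addn n) (std [seq x <- p | n < x]) = [seq x <- p | n < x].
Proof.
set w := [seq x <- p | n < x].
have ew : map (addn n) (map (subn^~ n) w) = w.
  rewrite -map_comp map_id_in // => x; rewrite mem_filter => /andP[nx _] /=.
  by rewrite subnKC // ltnW.
rewrite -[X in std X]ew std_map => [|x y _ _]; last by rewrite leq_add2l.
rewrite std_val ?ew // size_map; apply: (perm_map_inj (@addnI n)).
rewrite ew (perm_size perm_filter_gt) size_iota.
by apply: (perm_trans perm_filter_gt); rewrite -iotaDl addn1.
Qed.

Lemma size_std_filter_le : size (std [seq x <- p | x <= n]) = n.
Proof. by rewrite size_std_word (perm_size perm_filter_le) size_iota. Qed.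

End FilterPerm.

(** A word is a shuffle of words with disjoint alphabets exactly when its
restrictions to the two alphabets are these words. *)
Lemma mem_shifted_shuffle (s t p : wperm) :
  (p \in shifted_shuffle s t) =
    (std [seq x <- p | x <= size s] == s) && (std [seq x <- p | size s < x] == t).
Proof.
rewrite -(mem_map val_inj) map_shifted_shuffle /shifted_shuffle_words.
have std_add u : std (map (addn (size s)) u) = std u.
  by apply: std_map => x y _ _; rewrite leq_add2l.
have gtE : [seq x <- val p | size s < x]
    = [seq x <- val p | predC (leq^~ (size s)) x].
  by apply: eq_filter => x /=; rewrite ltnNge.
apply/idP/idP.
  case/(@filter_shuffle (leq^~ (size s))).
  - by apply/allP => x; rewrite mem_wperm => /andP[].
  - apply/allP => _ /mapP[x xt ->] /=; rewrite -ltnNge -[X in X < _]addn0.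
    by rewrite ltn_add2l; move: xt; rewrite mem_wperm => /andP[].
  by rewrite gtE => -> ->; rewrite std_add !std_wperm !eqxx.
case/andP=> /eqP es /eqP et.
have sp : size s <= size p.
  by rewrite -es size_std_word size_filter count_size.
have := mem_shuffle_filter (leq^~ (size s)) (val p).
by rewrite -gtE -(std_filter_gt sp) et -(std_filter_le sp) es.
Qed.

Lemma std_filter_le_le (p : wperm) m n : n <= m <= size p ->
  std [seq x <- std [seq x <- p | x <= m] | x <= n] = std [seq x <- p | x <= n].
Proof.
case/andP=> nm mp; rewrite std_filter_le // -filter_predI; congr std.
by apply: eq_filter => x /=; case: (leqP x n) => // xn; rewrite (leq_trans xn).
Qed.

Lemma std_filter_gt_le (p : wperm) n k : n + k <= size p ->
  std [seq x <- std [seq x <- p | n < x] | x <= k]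
  = std [seq x <- std [seq x <- p | x <= n + k] | n < x].
Proof.
move=> nkp; have np := leq_trans (leq_addr k n) nkp.
rewrite (std_filter_le nkp) -(@std_map (addn n)); last first.
  by move=> x y _ _; rewrite leq_add2l.
rewrite (eq_filter (a2 := preim (addn n) (leq^~ (n + k)))) => [|x /=]; last first.
  by rewrite leq_add2l.
rewrite -filter_map std_filter_gt // -!filter_predI; congr std.
by apply: eq_filter => x /=; rewrite andbC.
Qed.

Lemma std_filter_gt_gt (p : wperm) n k : n <= size p ->
  std [seq x <- std [seq x <- p | n < x] | k < x] = std [seq x <- p | n + k < x].
Proof.
move=> np; rewrite -(@std_map (addn n)); last by move=> x y _ _; rewrite leq_add2l.
rewrite (eq_filter (a2 := preim (addn n) (ltn (n + k)))) => [|x /=]; last first.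
  by rewrite ltn_add2l.
rewrite -filter_map std_filter_gt // -filter_predI; congr std.
apply: eq_filter => x /=; case: (ltnP (n + k) x) => // nx.
by rewrite (leq_ltn_trans (leq_addr k n)).
Qed.

Local Open Scope ring_scope.

(** * Free modules and class functions *)

Lemma sum_eq_mem (K : fieldType) (B : eqType) (A : seq B) (q : B) : uniq A ->
  \sum_(p <- A) (q == p)%:R = (q \in A)%:R :> K.
Proof.
elim: A => [|a A IHA] /= uA; first by rewrite big_nil.
case/andP: uA => aA uA; rewrite big_cons IHA // inE.
by case: eqP aA => [->|_] /=; rewrite ?add0r // => /negbTE ->; rewrite addr0.
Qed.

Section Malg.
Variables (K : fieldType) (B : choiceType).
Implicit Types x y : {malg K[B]}.

Lemma mcoeff_sum x b : x@_b = \sum_(q <- msupp x) x@_q * (q == b)%:R.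
Proof.
rewrite {1}[x]monalgE raddf_sum /=; apply: eq_bigr => q _.
by rewrite mcoeffU mulr_natr.
Qed.

Lemma sum_mcoeff_mem x (A : seq B) : uniq A ->
  \sum_(p <- A) x@_p = \sum_(q <- msupp x) x@_q * (q \in A)%:R.
Proof.
move=> uA; under eq_bigr do rewrite mcoeff_sum.
rewrite exchange_big /=; apply: eq_bigr => q _.
by rewrite -mulr_sumr sum_eq_mem.
Qed.

Lemma linext_id x : linext (fun b => << b >>) x = x.
Proof.
apply/malgP => b; rewrite /linext raddf_sum [RHS]mcoeff_sum /=.
by apply: eq_bigr => q _; rewrite mcoeffZ mcoeffU.
Qed.

Lemma mcoeff_linext (C : choiceType) (f : B -> {malg K[C]}) x c :
  (linext f x)@_c = \sum_(b <- msupp x) x@_b * (f b)@_c.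
Proof. by rewrite /linext raddf_sum /=; under eq_bigr do rewrite mcoeffZ. Qed.

Lemma eq_linext (V : lmodType K) (f g : B -> V) : f =1 g -> linext f =1 linext g.
Proof. by move=> e x; rewrite /linext; under eq_bigr do rewrite e. Qed.

Lemma linext_sub (V : lmodType K) (f g : B -> V) x :
  linext (fun b => f b - g b) x = linext f x - linext g x.
Proof.
by rewrite /linext -sumrB; under eq_bigr do rewrite scalerBr.
Qed.

Lemma linext_comp (V W : lmodType K) (h : {linear V -> W}) (f : B -> V) x :
  h (linext f x) = linext (fun b => h (f b)) x.
Proof.
by rewrite /linext linear_sum; apply: eq_bigr => b _; rewrite linearZ.
Qed.

(** Each class is represented by a chosen element, and [Q b] is the indicator of
the class of [b]; the choice of representatives avoids dividing by the sizes
of the classes. *)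
Lemma class_function_decomp (C : eqType) (c : B -> C) (Q : B -> {malg K[B]}) x :
  (forall b b', (Q b)@_b' = (c b' == c b)%:R) ->
  (forall b b', c b = c b' -> x@_b = x@_b') ->
  exists r : seq B, x = \sum_(b <- r) x@_b *: Q b.
Proof.
move=> HQ Hx; pose rep b := choose (fun b' => c b' == c b) b.
have repP b : c (rep b) = c b.
  by apply/eqP; apply: (chooseP (P := fun b' => c b' == c b)); rewrite eqxx.
have repE b b' : c b = c b' -> rep b = rep b'.
  move=> e; rewrite /rep e; apply: choose_id; by rewrite ?e.
set R := undup (map rep (msupp x)); exists R; apply/malgP => b.
transitivity (\sum_(i <- R) x@_b * (rep b == i)%:R).
  rewrite -mulr_sumr sum_eq_mem ?undup_uniq // mem_undup.
  case: (boolP (b \in msupp x)) => hb; first by rewrite map_f // mulr1.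
  by rewrite (mcoeff_outdom hb) !mul0r.
rewrite raddf_sum big_seq [RHS]big_seq; apply: eq_bigr => i.
rewrite mem_undup => /mapP[j _ ->]; rewrite /= mcoeffZ HQ repP.
case: (c b =P c j) => [e|ne].
  by rewrite (repE _ _ e) eqxx (Hx _ _ e) (Hx _ _ (repP j)).
by case: eqP => [/(congr1 c)|]; rewrite ?repP // !mulr0.
Qed.
End Malg.

(** * The product of FQSym *)

Section Algebra.
Variable K : fieldType.
Implicit Types x y z : FQSym K.

Lemma mcoeff_fqmul x y (p : wperm) :
  (fqmul x y)@_p = \sum_(n < (size p).+1)
     x@_(std [seq a <- p | (a <= n)%N]) * y@_(std [seq a <- p | (n < a)%N]).
Proof.
rewrite /fqmul mcoeff_linext.
under eq_bigr => s _ do rewrite mcoeff_linext mulr_sumr.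
under [RHS]eq_bigr => n _.
  rewrite [x@_ _]mcoeff_sum mulr_suml.
  under eq_bigr => s _ do rewrite [y@_ _]mcoeff_sum mulr_sumr.
  over.
rewrite [RHS]exchange_big; apply: eq_bigr => s _; rewrite [RHS]exchange_big /=.
apply: eq_bigr => t _.
under [RHS]eq_bigr do rewrite mulrACA -natrM mulnb.
rewrite -mulr_sumr mulrA; congr (_ * _).
rewrite raddf_sum /=; under eq_bigr do rewrite /F mcoeffU eq_sym.
rewrite sum_eq_mem ?shifted_shuffle_uniq // mem_shifted_shuffle.
case: (ltnP (size s) (size p).+1) => [sp|ps]; last first.
  rewrite big1 => [|n _].
    case: eqP => // /(congr1 (size \o word)) /=.
    rewrite size_std_word size_filter => e; move: ps; rewrite -e.
    by rewrite ltnNge count_size.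
  case: eqP => // /(congr1 (size \o word)) /=.
  have np : (n <= size p)%N by rewrite -ltnS.
  by rewrite size_std_filter_le // => e; move: ps; rewrite e leqNgt ltnS np.
rewrite (bigD1 (Ordinal sp)) //= big1 ?addr0 => [|n ns].
  by rewrite [s == _]eq_sym [t == _]eq_sym.
have np : (n <= size p)%N by rewrite -ltnS.
case: eqP => // /(congr1 (size \o word)) /=.
rewrite size_std_filter_le // => e.
by case/eqP: ns; apply: val_inj.
Qed.

Lemma fqmul_is_linear x : linear (fqmul x).
Proof.
move=> a y z; apply/malgP => p; rewrite [LHS]mcoeff_fqmul.
rewrite [RHS]mcoeffD [X in _ = X + _]mcoeffZ !mcoeff_fqmul.
rewrite mulr_sumr -big_split; apply: eq_bigr => n _ /=.
by rewrite mcoeffD mcoeffZ mulrDr mulrCA.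
Qed.

HB.instance Definition _ x :=
  GRing.isLinear.Build K (FQSym K) (FQSym K) *:%R (fqmul x) (fqmul_is_linear x).

Definition fqmulr y x := fqmul x y.

Lemma fqmulr_is_linear y : linear (fqmulr y).
Proof.
move=> a x z; apply/malgP => p; rewrite /fqmulr.
rewrite [LHS]mcoeff_fqmul [RHS]mcoeffD [X in _ = X + _]mcoeffZ !mcoeff_fqmul.
rewrite mulr_sumr -big_split; apply: eq_bigr => n _ /=.
by rewrite mcoeffD mcoeffZ mulrDl mulrA.
Qed.

HB.instance Definition _ y :=
  GRing.isLinear.Build K (FQSym K) (FQSym K) *:%R (fqmulr y) (fqmulr_is_linear y).

Lemma fqmul_suml I (r : seq I) (P : pred I) (f : I -> FQSym K) y :
  fqmul (\sum_(i <- r | P i) f i) y = \sum_(i <- r | P i) fqmul (f i) y.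
Proof. exact: (raddf_sum (fqmulr y)). Qed.

Lemma fqmul_sumr I (r : seq I) (P : pred I) (f : I -> FQSym K) x :
  fqmul x (\sum_(i <- r | P i) f i) = \sum_(i <- r | P i) fqmul x (f i).
Proof. exact: raddf_sum. Qed.

Lemma fqmulBl x y z : fqmul (x - y) z = fqmul x z - fqmul y z.
Proof. exact: (raddfB (fqmulr z)). Qed.

Lemma fqmulBr x y z : fqmul x (y - z) = fqmul x y - fqmul x z.
Proof. exact: raddfB. Qed.

Lemma fqmul0 x : fqmul x 0 = 0. Proof. exact: raddf0. Qed.
Lemma fq0mul x : fqmul 0 x = 0. Proof. exact: (raddf0 (fqmulr x)). Qed.

Lemma fqmul1 x : fqmul x (fqone K) = x.
Proof.
rewrite -[x in RHS]linext_id /fqmul; apply: eq_linext => s.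
rewrite linextU /shifted_shuffle /shifted_shuffle_words /= shuffle_nil /=.
by rewrite valK big_seq1.
Qed.

Lemma fq1mul x : fqmul (fqone K) x = x.
Proof.
rewrite -[x in RHS]linext_id /fqmul linextU; apply: eq_linext => s.
rewrite /shifted_shuffle /shifted_shuffle_words /= map_id /=.
by rewrite valK big_seq1.
Qed.

End Algebra.

(** The double sum behind associativity and coassociativity: cutting at [j] and
then at [i <= j], or at [i] and then [k] further. *)
Lemma sum_triangle (V : nmodType) (G : nat -> nat -> V) n :
  \sum_(j < n.+1) \sum_(i < j.+1) G i j
  = \sum_(i < n.+1) \sum_(k < (n - i).+1) G i (i + k)%N.
Proof.
elim: n => [|n IHn]; first by rewrite !big_ord_recl !big_ord0.
rewrite big_ord_recr /= IHn [RHS]big_ord_recr /= subnn big_ord1 addn0.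
rewrite [X in _ + X]big_ord_recr /= addrA -big_split /=; congr (_ + _).
apply: eq_bigr => i _; have le_in : (i <= n)%N by rewrite -ltnS.
by rewrite subSn // [RHS]big_ord_recr /= addnS subnKC.
Qed.

Section Assoc.
Variable K : fieldType.
Implicit Types x y z : FQSym K.

Lemma fqmulA x y z : fqmul x (fqmul y z) = fqmul (fqmul x y) z.
Proof.
apply/malgP => p; rewrite !mcoeff_fqmul.
pose G n m := x@_(std [seq a <- p | (a <= n)%N])
  * y@_(std [seq a <- std [seq a <- p | (a <= m)%N] | (n < a)%N])
  * z@_(std [seq a <- p | (m < a)%N]).
transitivity (\sum_(m < (size p).+1) \sum_(n < m.+1) G n m); last first.
  apply: eq_bigr => m _; have mp : (m <= size p)%N by rewrite -ltnS.
  rewrite mcoeff_fqmul mulr_suml size_std_filter_le //; apply: eq_bigr => n _.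
  by rewrite std_filter_le_le // -ltnS ltn_ord.
rewrite sum_triangle; apply: eq_bigr => n _.
have np : (n <= size p)%N by rewrite -ltnS.
rewrite mcoeff_fqmul mulr_sumr size_std_word (perm_size (perm_filter_gt np)).
rewrite size_iota; apply: eq_bigr => k _.
rewrite mulrA std_filter_gt_le ?std_filter_gt_gt //.
by rewrite -leq_subRL // -ltnS.
Qed.
End Assoc.

(** * Convolution and the antipode *)

(* From here on these are used through their equations only; unfolding them
   makes conversion very slow. *)
#[local] Opaque std fqmul.

Section Convolution.
Variable K : fieldType.
Implicit Types (f g h : wperm -> FQSym K) (s : wperm) (x : FQSym K).

(** Convolution of linear maps given by their values on the basis [F], see
[convolutionE]. *)
Definition conv f g s : FQSym K :=
  \sum_(i < (size s).+1) fqmul (f (std (take i s))) (g (std (drop i s))).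

Lemma convE f g s :
  conv f g s = \sum_(i < (size s).+1)
                 fqmul (f (std (take i s))) (g (std (drop i s))).
Proof. by []. Qed.

Definition unit_counit s : FQSym K := if size s == 0%N then fqone K else 0.

Lemma eq_conv f f' g g' s :
  (forall t : wperm, (size t <= size s)%N -> f t = f' t) ->
  (forall t : wperm, (size t <= size s)%N -> g t = g' t) ->
  conv f g s = conv f' g' s.
Proof.
move=> ef eg; apply: eq_bigr => i _.
by rewrite ef ?eg // size_std_word ?size_drop ?leq_subr // size_take_min geq_minr.
Qed.

(** Combines associativity of the product with coassociativity, which reads
[std (take i (std u)) = std (take i u)] and similarly for [drop]. *)
Lemma convA f g h s : conv f (conv g h) s = conv (conv f g) h s.
Proof.
have us := uniq_wperm s.
pose G i j := fqmul (fqmul (f (std (take i s))) (g (std (drop i (take j s)))))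
                    (h (std (drop j s))).
transitivity (\sum_(j < (size s).+1) \sum_(i < j.+1) G i j); last first.
  apply: eq_bigr => j _; have js : (j <= size s)%N by rewrite -ltnS.
  rewrite /conv fqmul_suml size_std_word (size_takel js); apply: eq_bigr => i _.
  have ij : (i <= j)%N by rewrite -ltnS.
  have ut := take_uniq j us.
  by rewrite (std_take_std _ ut) (std_drop_std _ ut) (take_takel _ ij).
rewrite sum_triangle; apply: eq_bigr => i _.
rewrite /conv fqmul_sumr size_std_word size_drop; apply: eq_bigr => k _.
have ud := drop_uniq i us.
rewrite (std_take_std _ ud) (std_drop_std _ ud) /G fqmulA.
by rewrite take_drop drop_drop addnC.
Qed.

Lemma conv1l f s : conv unit_counit f s = f s.
Proof.
rewrite /conv big_ord_recl /= /unit_counit size_std_word take0 /= drop0.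
rewrite std_wperm fq1mul big1 ?addr0 // => i _.
by rewrite size_std_word size_takel ?fq0mul // ltn_ord.
Qed.

Lemma conv1r f s : conv f unit_counit s = f s.
Proof.
rewrite /conv big_ord_recr /= /unit_counit size_std_word drop_size /= take_size.
rewrite std_wperm fqmul1 big1 ?add0r // => i _.
by rewrite size_std_word size_drop subn_eq0 leqNgt ltn_ord fqmul0.
Qed.

Lemma convBl f f' g s : conv (fun t => f t - f' t) g s = conv f g s - conv f' g s.
Proof. by rewrite /conv -sumrB; apply: eq_bigr => i _; rewrite fqmulBl. Qed.

Lemma convBr f g g' s : conv f (fun t => g t - g' t) s = conv f g s - conv f g' s.
Proof. by rewrite /conv -sumrB; apply: eq_bigr => i _; rewrite fqmulBr. Qed.

Definition reduced_id s : FQSym K := F K s - unit_counit s.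

(** The partial sums of the alternating series of convolution powers of
[reduced_id], in Horner form. *)
Fixpoint antipode_trunc N s : FQSym K :=
  if N is N'.+1 then unit_counit s - conv (antipode_trunc N') reduced_id s
  else unit_counit s.

Definition antipode s := antipode_trunc (size s) s.

Lemma reduced_id0 s : size s = 0%N -> reduced_id s = 0.
Proof.
move=> s0; rewrite /reduced_id /unit_counit s0 eqxx /fqone.
suff -> : s = wperm_nil by rewrite subrr.
by apply: val_inj; apply/size0nil.
Qed.

Lemma unit_counitE s :
  unit_counit s = if size s == 0%N then fqone K else 0.
Proof. by []. Qed.

#[local] Opaque conv unit_counit reduced_id.

(** The partial sums are polynomials in [reduced_id], so they commute with it;
this makes the left inverse for convolution a right inverse. *)
Lemma antipode_trunc_comm N s :
  conv (antipode_trunc N) reduced_id s = conv reduced_id (antipode_trunc N) s.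
Proof.
elim: N s => [|N IHN] s.
  by rewrite [LHS](conv1l reduced_id) [RHS](conv1r reduced_id).
rewrite [LHS]convBl [RHS]convBr.
rewrite (conv1l reduced_id s) (conv1r reduced_id s).
rewrite (convA reduced_id (antipode_trunc N) reduced_id s).
rewrite (@eq_conv (conv (antipode_trunc N) reduced_id)
  (conv reduced_id (antipode_trunc N)) reduced_id reduced_id) //.
Qed.

(** As [reduced_id] vanishes in degree 0, a new convolution factor lowers the
degree in which the previous partial sum is evaluated. *)
Lemma antipode_trunc_stable N s : (size s <= N)%N ->
  antipode_trunc N.+1 s = antipode_trunc N s.
Proof.
elim: N s => [|N IHN] s sN.
  by rewrite [LHS]/= (conv1l reduced_id) reduced_id0 ?subr0 //; apply/eqP; rewrite -leqn0.
rewrite [LHS]/= -/(antipode_trunc N.+1) [RHS]/=; congr (_ - _).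
rewrite !convE; apply: eq_bigr => i _; case: (ltnP i (size s)) => [si|si].
  by rewrite IHN // size_std_word size_takel ?(ltnW si) // -ltnS (leq_trans si).
by rewrite reduced_id0 ?fqmul0 // size_std_word size_drop; apply/eqP; rewrite subn_eq0.
Qed.

Lemma antipodeE N s : (size s <= N)%N -> antipode s = antipode_trunc N s.
Proof.
move=> sN; rewrite -(subnKC sN); elim: (N - size s)%N => [|k IHk].
  by rewrite addn0.
by rewrite addnS antipode_trunc_stable ?leq_addr.
Qed.

Lemma conv_id_r f s : conv f reduced_id s = conv f (F K) s - f s.
Proof. by rewrite -[in RHS](conv1r f s) -convBr. Qed.

Lemma conv_id_l f s : conv reduced_id f s = conv (F K) f s - f s.
Proof. by rewrite -[X in _ - X](conv1l f s) -convBl. Qed.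

(** Stability reads [A = unit_counit - A * reduced_id] in degrees that the
truncation [A] reaches, that is [A * id = unit_counit]. *)
Lemma antipode_trunc_l s :
  conv (antipode_trunc (size s)) (F K) s = unit_counit s.
Proof.
have := antipode_trunc_stable (leqnn (size s)).
rewrite [X in X = _]/= conv_id_r => /(canRL (subrK _)) ->.
by rewrite addrC subrK.
Qed.

Lemma antipode_trunc_r s :
  conv (F K) (antipode_trunc (size s)) s = unit_counit s.
Proof.
have := antipode_trunc_stable (leqnn (size s)).
rewrite [X in X = _]/= antipode_trunc_comm conv_id_l => /(canRL (subrK _)) ->.
by rewrite addrC subrK.
Qed.

Lemma antipode_l s : conv antipode (F K) s = unit_counit s.
Proof.
rewrite -antipode_trunc_l; apply: eq_conv => // t ts; exact: antipodeE.
Qed.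

Lemma antipode_r s : conv (F K) antipode s = unit_counit s.
Proof.
rewrite -antipode_trunc_r; apply: eq_conv => // t ts; exact: antipodeE.
Qed.
End Convolution.

(** * Class functions form a Hopf subalgebra *)

Section Linear.
Variable K : fieldType.
Implicit Types (f g : wperm -> FQSym K) (s t : wperm) (x y : FQSym K).

Lemma fqmul_linextl f x y : fqmul (linext f x) y = linext (fun s => fqmul (f s) y) x.
Proof. exact: (linext_comp (fqmulr y)). Qed.

Lemma fqmul_linextr g x y : fqmul x (linext g y) = linext (fun t => fqmul x (g t)) y.
Proof. exact: (linext_comp (fqmul x)). Qed.

Lemma linext_tensor f g x y :
  linext (fun st : wperm * wperm => fqmul (f st.1) (g st.2)) (tensor x y)
  = fqmul (linext f x) (linext g y).
Proof.
rewrite /tensor linext_comp fqmul_linextl; apply: eq_linext => s.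
rewrite linext_comp fqmul_linextr; apply: eq_linext => t.
exact: linextU.
Qed.

Lemma linext_conv f g x :
  linext (fun st : wperm * wperm => fqmul (f st.1) (g st.2)) (fqcomul x)
  = linext (conv f g) x.
Proof.
rewrite /fqcomul linext_comp; apply: eq_linext => s; rewrite linear_sum convE.
by apply: eq_bigr => i _; rewrite tensorFF; apply: linextU.
Qed.

Lemma convolutionE (f g : FQSym K -> FQSym K) x :
  convolution f g x = linext (conv (fun s => f (F K s)) (fun s => g (F K s))) x.
Proof. by rewrite -linext_conv. Qed.

Lemma mcoeff_tensor x y s t : (tensor x y)@_(s, t) = x@_s * y@_t.
Proof.
rewrite /tensor mcoeff_linext (mcoeff_sum x s) mulr_suml; apply: eq_bigr => s' _.
rewrite mcoeff_linext -mulrA (mcoeff_sum y t); congr (_ * _).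
rewrite mulr_sumr; apply: eq_bigr => t' _.
by rewrite mcoeffU xpair_eqE mulrCA -natrM mulnb.
Qed.

(** The indices of the terms that contribute to [F_s (x) F_t] in a coproduct. *)
Definition unsplit s t : seq wperm :=
  [seq p : wperm <- wperms (size s + size t) |
     (std (take (size s) p) == s) && (std (drop (size s) p) == t)].

Lemma unsplit_uniq s t : uniq (unsplit s t).
Proof.
by rewrite filter_uniq //; apply: pmap_sub_uniq; apply: permutations_uniq.
Qed.

Lemma mem_unsplit s t (p : wperm) : (p \in unsplit s t) =
  [&& std (take (size s) p) == s, std (drop (size s) p) == t
    & size p == (size s + size t)%N].
Proof. by rewrite mem_filter mem_wperms andbA. Qed.

Lemma mcoeff_fqcomul x s t : (fqcomul x)@_(s, t) = \sum_(p <- unsplit s t) x@_p.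
Proof.
rewrite sum_mcoeff_mem ?unsplit_uniq //.
rewrite /fqcomul mcoeff_linext; apply: eq_bigr => p _; congr (_ * _).
rewrite raddf_sum /= mem_unsplit andbA.
under eq_bigr do rewrite tensorFF mcoeffU xpair_eqE.
have [e|ne] := eqVneq (size p) (size s + size t)%N; last first.
  rewrite andbF big1 // => i _; case: eqP => //= es; case: eqP => //= et.
  case/eqP: ne; rewrite -es -et !size_std_word -size_cat.
  by rewrite cat_take_drop.
have sp : (size s < (size p).+1)%N by rewrite ltnS e leq_addr.
rewrite (bigD1 (Ordinal sp)) //= big1 ?addr0 ?andbT // => i ne.
case: eqP => //= es; case/eqP: ne; apply: val_inj => /=.
by rewrite -es size_std_word size_takel // -ltnS.
Qed.

Definition class_function x := forall s t, P_symbol s = P_symbol t -> x@_s = x@_t.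

(** The twin condition holds for every [P_symbol s], so no class is missing from
the family [PJ]. *)
Lemma lin_span_PJP x : lin_span (@PJ K) x <-> class_function x.
Proof.
split=> [[r ->] s t e|hx].
  rewrite !raddf_sum; apply: eq_bigr => -[a J] _ /=.
  by rewrite !mcoeffZ !mcoeff_PJ e.
pose cls s : TBT := exist _ (P_symbol s) (P_symbol_twin s).
have [|r e] := class_function_decomp (c := fun s : wperm => P_symbol s)
    (Q := fun s => PJ K (cls s)) _ hx.
  by move=> s t; rewrite mcoeff_PJ.
by exists [seq (x@_s, cls s) | s <- r]; rewrite big_map {1}e.
Qed.

Lemma class_function_fqone : class_function (fqone K).
Proof.
move=> s t e; rewrite /fqone /F !mcoeffU.
have h (u : wperm) : (wperm_nil == u) = (nodes (P_symbol u).1 == 0%N).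
  rewrite nodes_P_symbol eq_sym; apply/eqP/eqP => [-> //|/size0nil u0].
  exact: val_inj.
by rewrite !h e.
Qed.

Lemma class_function_lin a x y : class_function x -> class_function y ->
  class_function (a *: x + y).
Proof.
by move=> hx hy s t e; rewrite !mcoeffD !mcoeffZ (hx _ _ e) (hy _ _ e).
Qed.

Lemma class_function_fqmul x y : class_function x -> class_function y ->
  class_function (fqmul x y).
Proof.
move=> hx hy s t e; rewrite !mcoeff_fqmul (perm_size (P_symbol_perm e)).
apply: eq_bigr => n _; congr (_ * _); [apply: hx|apply: hy].
  by rewrite !P_symbol_std ?filter_uniq ?uniq_wperm //; apply: P_symbol_filter_le.
by rewrite !P_symbol_std ?filter_uniq ?uniq_wperm //; apply: P_symbol_filter_gt.
Qed.

(** [reassemble s' t'] is a bijection from [unsplit s t] to [unsplit s' t'] with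
inverse [reassemble s t], and it moves each permutation within its class. *)
Lemma mcoeff_fqcomul_class x s t s' t' : class_function x ->
  P_symbol s = P_symbol s' -> P_symbol t = P_symbol t' ->
  (fqcomul x)@_(s, t) = (fqcomul x)@_(s', t').
Proof.
move=> hx es et; rewrite !mcoeff_fqcomul.
have ss := perm_size (P_symbol_perm es); have st := perm_size (P_symbol_perm et).
have unsplitK (u v u' v' p : wperm) : size u = size u' -> size v = size v' ->
    p \in unsplit u v -> reassemble u v (reassemble u' v' p) = p.
  move=> su sv; rewrite mem_unsplit => /and3P[/eqP e1 /eqP e2 /eqP sz].
  by apply: reassembleK; rewrite -?su -?sv.
have mem_reassemble (u v u' v' p : wperm) :
    size u = size u' -> size v = size v' ->
    p \in unsplit u v -> reassemble u' v' p \in unsplit u' v'.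
  move=> su sv; rewrite !mem_unsplit => /and3P[_ _ /eqP sz].
  have sz' : size p = (size u' + size v')%N by rewrite -su -sv.
  by rewrite std_take_reassemble // std_drop_reassemble // size_reassemble // !eqxx.
have pA : perm_eq (map (reassemble s' t') (unsplit s t)) (unsplit s' t').
  apply: uniq_perm; [|exact: unsplit_uniq|].
    rewrite map_inj_in_uniq ?unsplit_uniq // => p q pA qA e.
    by rewrite -(unsplitK s t s' t' p ss st pA) e (unsplitK s t s' t' q ss st qA).
  move=> p; apply/mapP/idP => [[q qA ->]|pA']; first exact: (mem_reassemble s t).
  exists (reassemble s t p); first exact: (mem_reassemble s' t').
  by rewrite (unsplitK s' t' s t).
rewrite -(perm_big _ pA) big_map big_seq [RHS]big_seq; apply: eq_bigr => p.
rewrite mem_unsplit => /and3P[/eqP e1 /eqP e2 /eqP sz].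
apply/hx/esym/P_symbol_reassemble; first by rewrite -ss -st.
  by rewrite -ss e1.
by rewrite -ss e2.
Qed.

Lemma tensor_square_fqcomul x : class_function x ->
  tensor_square class_function (fqcomul x).
Proof.
move=> hx; pose cls s : TBT := exist _ (P_symbol s) (P_symbol_twin s).
pose c (st : wperm * wperm) := (P_symbol st.1, P_symbol st.2).
have [||r e] := class_function_decomp (c := c)
    (Q := fun st => tensor (PJ K (cls st.1)) (PJ K (cls st.2))) (x := fqcomul x).
- by move=> [s t] [s' t']; rewrite mcoeff_tensor !mcoeff_PJ -natrM mulnb.
- move=> [s t] [s' t'] /eqP; rewrite xpair_eqE /= => /andP[/eqP es /eqP et].
  exact: mcoeff_fqcomul_class.
have hPJ J : class_function (PJ K J).
  by move=> s t est; rewrite !mcoeff_PJ est.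
exists [seq ((fqcomul x)@_st *: PJ K (cls st.1), PJ K (cls st.2)) | st <- r].
  move=> _ /mapP[st _ ->] /=; split; last exact: hPJ.
  by move=> s t est; rewrite !mcoeffZ (hPJ _ _ _ est).
rewrite big_map {1}e; apply: eq_bigr => st _ /=.
by rewrite [RHS]/tensor linearZ.
Qed.

(** The coproduct of a class function is a sum of tensors of class functions, on
which the convolution of [f] and [g] acts factor by factor. *)
Lemma class_function_conv f g :
  (forall x, class_function x -> class_function (linext f x)) ->
  (forall x, class_function x -> class_function (linext g x)) ->
  forall x, class_function x -> class_function (linext (conv f g) x).
Proof.
move=> hf hg x /tensor_square_fqcomul [r hr e].
rewrite -linext_conv e linear_sum /= big_seq.
apply: big_ind => [s t _|y z hy hz|p pr]; first by rewrite !mcoeff0.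
  by rewrite -[y]scale1r; apply: class_function_lin.
rewrite linext_tensor; have [h1 h2] := hr p pr.
by apply: class_function_fqmul; [apply: hf|apply: hg].
Qed.

Lemma linext_unit_counit x : linext (@unit_counit K) x = fqcounit x *: fqone K.
Proof.
rewrite /fqcounit (mcoeff_sum x) scaler_suml; apply: eq_bigr => s _.
rewrite -scalerA; congr (_ *: _).
have -> : (s == wperm_nil) = (size s == 0%N).
  by apply/eqP/eqP => [-> //|/size0nil s0]; apply: val_inj.
by rewrite unit_counitE; case: eqP => _; rewrite ?scale1r ?scale0r.
Qed.

Lemma class_function_sub x y : class_function x -> class_function y ->
  class_function (x - y).
Proof. by move=> hx hy s t e; rewrite !mcoeffB (hx _ _ e) (hy _ _ e). Qed.

Lemma class_function_unit x : class_function x ->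
  class_function (linext (@unit_counit K) x).
Proof.
move=> _; rewrite linext_unit_counit => s t e.
by rewrite !mcoeffZ (class_function_fqone e).
Qed.

Lemma class_function_antipode_trunc N x : class_function x ->
  class_function (linext (@antipode_trunc K N) x).
Proof.
elim: N x => [|N IHN] x hx; first exact: class_function_unit.
rewrite (linext_sub (@unit_counit K) (conv (@antipode_trunc K N) (@reduced_id K))).
apply: class_function_sub; first exact: class_function_unit.
apply: class_function_conv hx => // y hy.
rewrite (linext_sub (F K) (@unit_counit K)) /F linext_id.
by apply: class_function_sub => //; apply: class_function_unit.
Qed.

(** The support is finite, so a single truncation computes the antipode on all
of it. *)
Lemma class_function_antipode x : class_function x ->
  class_function (linext (@antipode K) x).
Proof.
move=> hx; pose N := (\sum_(s <- msupp x) size s)%N.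
suff -> : linext (@antipode K) x = linext (@antipode_trunc K N) x.
  exact: class_function_antipode_trunc.
rewrite /linext big_seq [RHS]big_seq; apply: eq_bigr => s sx; congr (_ *: _).
by apply: antipodeE; rewrite /N (big_rem s) //= leq_addr.
Qed.

Lemma antipodeP : is_antipode (linext (@antipode K)).
Proof.
move=> x; rewrite !convolutionE -linext_unit_counit.
split; apply: eq_linext => s.
  by rewrite -antipode_l; apply: eq_conv => t _ //; apply: linextU.
by rewrite -antipode_r; apply: eq_conv => t _ //; apply: linextU.
Qed.
End Linear.

Theorem theorem6p2 (K : fieldType) (charK : [pchar K]%R =i pred0) :
  is_hopf_subalgebra (@lin_span K TBT (@PJ K)).
Proof.
split.
- split; first by exists [::]; rewrite big_nil.
  move=> a x y /lin_span_PJP hx /lin_span_PJP hy; apply/lin_span_PJP.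
  exact: class_function_lin.
- exact/lin_span_PJP/class_function_fqone.
- move=> x y /lin_span_PJP hx /lin_span_PJP hy; apply/lin_span_PJP.
  exact: class_function_fqmul.
- move=> x /lin_span_PJP/tensor_square_fqcomul [r hr ->]; exists r => // p.
  by move=> /hr[h1 h2]; split; apply/lin_span_PJP.
exists (linext (@antipode K)); first exact: antipodeP.
by move=> x /lin_span_PJP/class_function_antipode/lin_span_PJP.
Qed.
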